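(* Let $f\colon\mathbb{R}^n\to[-\infty,+\infty]$ be absolutely symmetric, lower semicontinuous, convex, and locally Lipschitz continuous relative to its domain. Let $\mu_1>\dots>\mu_t$ be the distinct nonzero singular values of $X\in\mathbb{M}_{m,n}$, let $Y\in\partial(f\circ\sigma)(X)$, and assume that $f$ is parabolically epi-differentiable at $\sigma(X)$ and parabolically regular at $\sigma(X)$ for $\sigma(Y)$. Then $f\circ\sigma$ is parabolically regular at $X$ for $Y$, and for any $H\in K_{f\circ\sigma}(X,Y)$, $$\begin{aligned}\mathrm{d}^2(f\circ\sigma)(X\mid Y)(H)={}&\mathrm{d}^2f(\sigma(X)\mid\sigma(Y))(\sigma'(X;H))\\&+2\sum_{i=1}^t\Big\langle\Sigma(Y)_{\alpha_i\alpha_i},\,P_{\alpha_i}^T\mathcal{B}(H)P_{\alpha_i}^c(\mu_iI-\varLambda_{\alpha_i})^{-1}(P_{\alpha_i}^c)^T\mathcal{B}(H)P_{\alpha_i}\Big\rangle\\&+2\Big\langle\Sigma(Y)_{\hat\beta\beta},\,-U_{\hat\beta}^THV_\alpha\Sigma_\alpha^{-1}(X)U_\alpha^THV_\beta\Big\rangle,\end{aligned}$$ where $(U,V)\in\mathcal{O}^{m,n}(X)\cap\mathcal{O}^{m,n}(Y)$.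
   Context: Matrix notation. $m,n$ are natural numbers, $n\le m$; $\mathbb{M}_{m,n}$ is the space of real $m\times n$ matrices, $\langle A,B\rangle=\mathrm{tr}(A^TB)$, Frobenius norm. $\sigma(X)$ is the vector of singular values in nonincreasing order, $\Sigma(X)$ the $m\times n$ diagonal matrix with diagonal $\sigma(X)$. $\mathcal{O}^{m,n}(X)$ is the set of pairs $(U,V)$ of orthogonal matrices ($m\times m$, $n\times n$) with $X=U\Sigma(X)V^T$. With $r=\mathrm{rank}\,X$: $\alpha=\{1,\dots,r\}$, $\beta=\{r+1,\dots,n\}$, $\beta_0=\{n+1,\dots,m\}$, $\hat\beta=\beta\cup\beta_0$, $\alpha_i=\{s\in\alpha:\sigma_s(X)=\mu_i\}$. $U_I$, $V_I$ denote the submatrices of columns indexed by $I$; $A_{IJ}$ is the submatrix of $A$ with rows in $I$ and columns in $J$; $\Sigma_\alpha(X)$ is the $r\times r$ diagonal matrix with diagonal $\sigma_1(X),\dots,\sigma_r(X)$. $\mathcal{B}(X)=\begin{bmatrix}0&X\\ X^T&0\end{bmatrix}$, and $P=\frac1{\sqrt2}\begin{bmatrix}U_\alpha&U_\beta&\sqrt2U_{\beta_0}&-U_\alpha&-U_\beta\\ V_\alpha&V_\beta&0&V_\alpha&V_\beta\end{bmatrix}$, an orthogonal matrix diagonalizing $\mathcal{B}(X)$. $P_{\alpha_i}=\frac1{\sqrt2}\begin{bmatrix}U_{\alpha_i}\\ V_{\alpha_i}\end{bmatrix}$ consists of the columns of $P$ forming an orthonormal basis of eigenvectors of $\mathcal{B}(X)$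 for $\mu_i$; $P_{\alpha_i}^c$ is $P$ with those columns removed; $\varLambda_{\alpha_i}$ is the diagonal matrix of size $m+n-|\alpha_i|$ of the diagonal entries of $P^T\mathcal{B}(X)P$ different from $\mu_i$, in the order of the columns of $P_{\alpha_i}^c$. Variational notions. $\sigma'(X;H)=\lim_{t\downarrow0}(\sigma(X+tH)-\sigma(X))/t$ (always exists). $f$ is absolutely symmetric if $f(Qx)=f(x)$ for all $x$ and all signed permutation matrices $Q$. $g$ is locally Lipschitz continuous relative to its domain if for every $\bar x\in\mathrm{dom}\,g=\{g<\infty\}$, $g(\bar x)$ is finite and $g$ is Lipschitz on $O\cap\mathrm{dom}\,g$ for some neighborhood $O$ of $\bar x$. $\partial$ is the convex subdifferential. For $g$ with $g(\bar x)$ finite: $\mathrm{d}g(\bar x)(w)=\liminf_{t\downarrow0,w'\to w}\frac{g(\bar x+tw')-g(\bar x)}t$; second subderivative $\mathrm{d}^2g(\bar x\mid v)(w)=\liminf_{\tau\downarrow0,w'\to w}\frac{g(\bar x+\tau w')-g(\bar x)-\tau\langle v,w'\rangle}{\frac12\tau^2}$; critical cone $K_g(\bar x,v)=\{w:\mathrm{d}g(\bar x)(w)=\langle v,w\rangle\}$; for $\mathrm{d}g(\bar x)(w)$ finite, parabolic subderivative $\mathrm{d}^2g(\bar x)(w\mid z)=\liminf_{\tau\downarrow0,z'\to z}\frac{g(\bar x+\tau w+\frac12\tau^2z')-g(\bar x)-\tau\mathrm{d}g(\bar x)(w)}{\frac12\tau^2}$. $g$ is parabolically epi-differentiable at $\bar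 x$ if for every $w$ with $\mathrm{d}g(\bar x)(w)$ finite: $\mathrm{dom}\,\mathrm{d}^2g(\bar x)(w\mid\cdot)\neq\emptyset$ and for every $z$ and $\tau_k\downarrow0$ there is $z_k\to z$ with $\frac{g(\bar x+\tau_kw+\frac12\tau_k^2z_k)-g(\bar x)-\tau_k\mathrm{d}g(\bar x)(w)}{\frac12\tau_k^2}\to\mathrm{d}^2g(\bar x)(w\mid z)$. $g$ is parabolically regular at $\bar x$ for $v$ if $g(\bar x)$ is finite and $\mathrm{d}^2g(\bar x\mid v)(w)=\inf_z\{\mathrm{d}^2g(\bar x)(w\mid z)-\langle v,z\rangle\}$ for every $w\in K_g(\bar x,v)$. *)

(* Defs.v *)
From HB Require Import structures.
From mathcomp Require Import all_boot all_order all_fingroup all_algebra.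
From mathcomp Require Import sesquilinear spectral complex.
From mathcomp Require Import all_classical all_reals all_analysis.

Set Implicit Arguments.
Unset Strict Implicit.
Unset Printing Implicit Defensive.

Import Order.TTheory GRing.Theory Num.Theory.
Import numFieldNormedType.Exports.

Local Open Scope classical_set_scope.
Local Open Scope ring_scope.

(* R^n is 'cV[R]_n, so that the notions below, stated for functions on a space
   of matrices, apply both to f and to f \o sing_vals. *)
Section EuclideanMatrices.
Context {R : realType} {p q : nat}.
Implicit Types A B : 'M[R]_(p, q).

Definition inner A B : R := \tr (A^T *m B).

Definition frobenius A : R := Num.sqrt (inner A A).

End EuclideanMatrices.

Section VariationalAnalysis.
Context {R : realType} {p q : nat}.
Notation E := 'M[R]_(p, q).
Implicit Types (g : E -> \bar R) (x v w z : E).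

Definition edom g : set E := [set x | (g x < +oo)%E].

Definition epigraph g : set (convex_lmodType (E * R^o)%type) :=
  [set xa | (g xa.1 <= xa.2%:E)%E].

Definition econvex g : Prop := convex_set (epigraph g).

Definition locally_lipschitz_rel_dom g : Prop :=
  forall x, edom g x -> g x \is a fin_num /\
    exists2 O : set E, nbhs x O &
    exists k : R, forall y z, (O `&` edom g) y -> (O `&` edom g) z ->
      `|fine (g y) - fine (g z)| <= k * frobenius (y - z).

Definition subdifferential g x : set E :=
  [set v | g x \is a fin_num /\
    forall y, (g x + (inner v (y - x))%:E <= g y)%E].

(* lower limit as t decreases to 0 and w' tends to w *)
Definition liminf_right (phi : R -> E -> \bar R) w : \bar R :=
  limf_einf (fun tw : (R * E)%type => phi tw.1 tw.2)
            (filter_prod 0^'+ (nbhs w)).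

Definition subderivative g x w : \bar R :=
  liminf_right
    (fun t w' => ((g (x + t *: w')%R - g x) * (t^-1)%:E)%E) w.

Definition second_subderivative g x v w : \bar R :=
  liminf_right
    (fun t w' => ((g (x + t *: w')%R - g x - (t * inner v w')%:E)
                  * ((2^-1 * t ^+ 2)^-1)%:E)%E) w.

Definition critical_cone g x v : set E :=
  [set w | subderivative g x w = (inner v w)%:E].

Definition parabolic_quotient g x w (t : R) z : \bar R :=
  ((g (x + t *: w + (2^-1 * t ^+ 2) *: z)%R - g x
    - t%:E * subderivative g x w) * ((2^-1 * t ^+ 2)^-1)%:E)%E.

Definition parabolic_subderivative g x w z : \bar R :=
  liminf_right (parabolic_quotient g x w) z.

Definition parabolically_epi_differentiable g x : Prop :=
  g x \is a fin_num /\
  forall w, subderivative g x w \is a fin_num ->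
    edom (parabolic_subderivative g x w) !=set0 /\
    forall z (tau : nat -> R), (forall k, 0 < tau k) -> tau @ \oo --> (0 : R) ->
      exists2 zs : nat -> E, zs @ \oo --> z &
        parabolic_quotient g x w (tau k) (zs k) @[k --> \oo]
          --> parabolic_subderivative g x w z.

Definition parabolically_regular g x v : Prop :=
  g x \is a fin_num /\
  forall w, critical_cone g x v w ->
    second_subderivative g x v w =
    ereal_inf (range (fun z =>
      (parabolic_subderivative g x w z - (inner v z)%:E)%E)).

End VariationalAnalysis.

Section AbsolutelySymmetric.
Context {R : realType} {n : nat}.

Definition signed_perm_mx (Q : 'M[R]_n) : Prop :=
  exists (s : 'S_n) (e : 'I_n -> bool),
    Q = diag_mx (\row_i (-1) ^+ e i) *m perm_mx s.

Definition absolutely_symmetric (f : 'cV[R]_n -> \bar R) : Prop :=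
  forall x Q, signed_perm_mx Q -> f (Q *m x) = f x.

End AbsolutelySymmetric.

Section SingularValues.
Context {R : realType} {m n : nat}.
Implicit Types X H : 'M[R]_(m, n).

(* s lists, in nonincreasing order and with multiplicities, the nonnegative
   square roots of the eigenvalues of X^T X *)
Definition is_sing_vals X (s : 'cV[R]_n) : Prop :=
  [/\ forall i, 0 <= s i 0,
      forall i j : 'I_n, (i <= j)%N -> s j 0 <= s i 0 &
      char_poly (X^T *m X) = \prod_(i < n) ('X - (s i 0 ^+ 2)%:P)].

(* the default value 0 is never used, by sing_valsP below *)
Definition sing_vals X : 'cV[R]_n := xget 0 [set s | is_sing_vals X s].

Lemma sing_valsP X : is_sing_vals X (sing_vals X).
Proof.
rewrite /sing_vals; apply: (@xgetPex _ 0 [set s | is_sing_vals X s]).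
pose toC := real_complex R.
pose A := X^T *m X; pose Ac := map_mx toC A.
have [rs Ers] := closed_field_poly_normal (char_poly Ac).
move: Ers; rewrite (monicP (char_poly_monic _)) scale1r => Ers.
have rs_ge0 z : z \in rs -> 0 <= z.
  move=> zrs; have : root (char_poly Ac) z by rewrite Ers root_prod_XsubC.
  rewrite -eigenvalue_root_char => /eigenvalueP [v vA v0].
  pose u := v *m (map_mx toC X)^T.
  have E : dotmx u u = z * dotmx v v.
    rewrite !dotmxE /u trmx_mul trmxK map_mxM mulmxA -[v *m _ *m _]mulmxA.
    have -> : map_mx Num.conj (map_mx toC X)= map_mx toC X.
      by apply/matrixP => i j; rewrite !mxE; apply: conj_Creal; rewrite complex_real.
    have -> : (map_mx toC X)^T *m map_mx toC X = Ac.
      by rewrite /Ac /A map_mxM map_trmx.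
    by rewrite vA -scalemxAl mxE.
  have v_gt0 : 0 < dotmx v v by rewrite dnorm_gt0.
  have u_ge0 : 0 <= dotmx u u by rewrite dnorm_ge0.
  by rewrite -(pmulr_lge0 _ v_gt0) -E.
pose d := sort (>=%R) [seq complex.Re z | z <- rs].
have Erd : rs = [seq toC r | r <- [seq complex.Re z | z <- rs]].
  rewrite -map_comp -[LHS]map_id; apply/eq_in_map; case=> a b /rs_ge0.
  by rewrite lecE /= => /andP[/eqP-> _].
have EA : char_poly A = \prod_(r <- d) ('X - r%:P).
  apply: (@map_poly_inj _ _ toC).
  rewrite map_char_poly -/Ac Ers rmorph_prod {1}Erd big_map.
  rewrite (perm_big _ (permEl (perm_sort _ _))) /=.
  by apply: eq_bigr => r _; rewrite rmorphB /= map_polyX map_polyC.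
have d_ge0 r : r \in d -> 0 <= r.
  rewrite mem_sort => /mapP[z /rs_ge0 + ->].
  by rewrite lecE /= => /andP[].
have size_d : size d = n.
  have := size_char_poly A; rewrite EA size_prod_XsubC => -[].
  by [].
exists (\col_i Num.sqrt (nth 0 d i)); split.
- by move=> i; rewrite mxE sqrtr_ge0.
- move=> i j ij; rewrite !mxE ler_wsqrtr//.
  have /(sorted_leq_nth ge_trans ge_refl) : sorted (>=%R) d.
    exact: sort_sorted ge_total _.
  by apply; rewrite ?inE ?size_d.
- rewrite -/A EA (big_nth 0) size_d big_mkord; apply: eq_bigr => i _.
  by rewrite mxE sqr_sqrtr// d_ge0// mem_nth// size_d.
Qed.

Definition sing_vals_dderiv X H : 'cV[R]_n :=
  lim (t^-1 *: (sing_vals (X + t *: H) - sing_vals X) @[t --> (0 : R)^'+]).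

Definition Sigma X : 'M[R]_(m, n) :=
  \matrix_(i, j) (sing_vals X j 0 *+ (i == j :> nat)).

Definition orthogonal_mx k (U : 'M[R]_k) : Prop := U^T *m U = 1%:M.

Definition svd_pairs X : set ('M[R]_m * 'M[R]_n) :=
  [set UV | [/\ orthogonal_mx UV.1, orthogonal_mx UV.2 &
                X = UV.1 *m Sigma X *m UV.2^T]].

Definition sym_dilation X : 'M[R]_(m + n) := block_mx 0 X X^T 0.

End SingularValues.

(* Indices are numbered from 0, and the positions of a submatrix follow the
   increasing enumeration of its index set. The sets alpha, beta and alpha_mu X
   mu_i, which index columns of both U and V, are subsets of 'I_n; hnm embeds
   'I_n into 'I_m. *)
Section IndexSets.
Context {R : realType} {m n : nat}.
Implicit Type X : 'M[R]_(m, n).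

Definition alpha X : {set 'I_n} := [set s : 'I_n | (s < \rank X)%N]%SET.
Definition beta X : {set 'I_n} := [set s : 'I_n | (\rank X <= s)%N]%SET.
Definition beta0 : {set 'I_m} := [set s : 'I_m | (n <= s)%N]%SET.
Definition betahat X : {set 'I_m} := [set s : 'I_m | (\rank X <= s)%N]%SET.
Definition alpha_mu X (mu : R) : {set 'I_n} :=
  [set s in alpha X | sing_vals X s 0 == mu]%SET.

Definition idx k (I : {set 'I_k}) (a : 'I_#|I|) : 'I_k := enum_val a.

Definition widx (hnm : (n <= m)%N) (I : {set 'I_n}) (a : 'I_#|I|) : 'I_m :=
  widen_ord hnm (idx a).

End IndexSets.

Arguments idx {k} I.
Arguments widx {m n} hnm I.
Arguments beta0 : clear implicits.

Section Formula.
Context {R : realType} {m n : nat} (hnm : (n <= m)%N).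
Variables (X : 'M[R]_(m, n)) (U : 'M[R]_m) (V : 'M[R]_n).
Implicit Types (H Y : 'M[R]_(m, n)) (mu : R).

Let U_ (I : {set 'I_n}) := colsub (widx hnm I) U.
Let V_ (I : {set 'I_n}) := colsub (idx I) V.

Definition Pmx :
    'M[R]_(m + n, #|alpha X| + #|beta X| + #|beta0 m n|
                  + #|alpha X| + #|beta X|) :=
  (Num.sqrt 2)^-1 *:
  col_mx
    (row_mx (row_mx (row_mx (row_mx (U_ (alpha X)) (U_ (beta X)))
                            (Num.sqrt 2 *: colsub (idx (beta0 m n)) U))
                    (- U_ (alpha X)))
            (- U_ (beta X)))
    (row_mx (row_mx (row_mx (row_mx (V_ (alpha X)) (V_ (beta X)))
                            0)
                    (V_ (alpha X)))
            (V_ (beta X))).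

Definition Pmu mu : 'M[R]_(m + n, #|alpha_mu X mu|) :=
  (Num.sqrt 2)^-1 *: col_mx (U_ (alpha_mu X mu)) (V_ (alpha_mu X mu)).

Let D := Pmx^T *m sym_dilation X *m Pmx.

(* For (U, V) in svd_pairs X the matrix D is diagonal, and for mu > 0 the
   columns of Pmx dropped here are exactly those of Pmu mu. *)
Definition non_mu mu := [set k | D k k != mu]%SET.

Definition Pmu_c mu : 'M[R]_(m + n, #|non_mu mu|) :=
  colsub (idx (non_mu mu)) Pmx.

Definition Lambda_mu mu : 'M[R]_#|non_mu mu| :=
  diag_mx (\row_k D (idx (non_mu mu) k) (idx (non_mu mu) k)).

Definition alpha_term Y H mu : R :=
  inner (mxsub (widx hnm (alpha_mu X mu)) (idx (alpha_mu X mu)) (Sigma Y))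
    ((Pmu mu)^T *m sym_dilation H *m Pmu_c mu
     *m invmx (mu%:M - Lambda_mu mu)
     *m (Pmu_c mu)^T *m sym_dilation H *m Pmu mu).

Definition Sigma_alpha : 'M[R]_#|alpha X| :=
  mxsub (widx hnm (alpha X)) (idx (alpha X)) (Sigma X).

Definition beta_term Y H : R :=
  inner (mxsub (idx (betahat X)) (idx (beta X)) (Sigma Y))
    (- (colsub (idx (betahat X)) U)^T *m H *m V_ (alpha X)
     *m invmx Sigma_alpha
     *m (U_ (alpha X))^T *m H *m V_ (beta X)).

End Formula.

(* Main.v *)
Require Import Defs.
From HB Require Import structures.
From mathcomp Require Import all_boot all_order all_fingroup all_algebra.
From mathcomp Require Import all_classical all_reals all_analysis.
From mathcomp Require Import ring lra zify.

Set Implicit Arguments.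
Unset Strict Implicit.
Unset Printing Implicit Defensive.

Import Order.TTheory GRing.Theory Num.Theory.
Import numFieldNormedType.Exports.

Local Open Scope classical_set_scope.
Local Open Scope ring_scope.

(** Write g = f o sigma, x = sigma(X), y = sigma(Y), and dg v for the rectangular
    diagonal matrix with diagonal v.

    Von Neumann's trace inequality <A,B> <= <sigma(A),sigma(B)> rules both the
    first and the second order.  A family of matrices attaining equality pairwise
    has a common singular value decomposition (common_svd).  A subgradient Y of g
    at X attains equality with X, so X = U dg(x) V^T and Y = U dg(y) V^T, and y is
    a subgradient of f at x.

    A direction H splits as H = AX - XB + H0 with A, B skew-symmetric, where
    AX - XB is tangent to the orbit of X under the orthogonal groups, and H0 is
    normal to it: XH0^T and X^TH0 are symmetric.  Then X and H0 are
    simultaneously diagonal (simultaneous_diag, by maximizing a linear function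
    over the stabilizer of X), sigma is affine along H0, and
    h = sigma'(X;H) is the diagonal of H0.  For critical H the chain
    <Y,H> <= <y,h> <= df(x)(h) <= dg(X)(H) = <Y,H> consists of equalities.  Hence
    h is critical for f, and X, X + sH0 and Y attain equality pairwise, so that
    H0 = U dg(h) V^T in a frame (U,V) common with Y.

    Let P(t), Q(t) be the Cayley curves of A and B, which are orthogonal and agree
    with the exponentials to second order.
    - Lower bound: sigma(X+tW) pairs with y at least as much as X + tW pairs with
      P(t) Y Q(t)^T.  Adding this to the second-order quotients of f gives
      d2g(X|Y)(H) >= d2f(x|y)(h) + q with q = <AY - YB, H>.
    - Upper bound: along P(t) U dg(x + th + t^2 z/2) V^T Q(t)^T, an arc with
      velocity H, g takes the values of f at x + th + t^2 z/2.  Its second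
      derivative Z satisfies <Y,Z> = <y,z> - q, whence
      d2g(X)(H|Z) - <Y,Z> <= d2f(x)(h|z) - <y,z> + q.
    Parabolic arcs always bound the second subderivative from above, so with the
    parabolic regularity of f the two bounds coincide; this is the parabolic
    regularity of g together with d2g(X|Y)(H) = d2f(x|y)(h) + q.

    In coordinates of a common frame, A and B are given by explicit quotients
    (genA, genB), and a partial fraction expansion turns q into the sum over the
    positive singular values and the term of the zero singular value
    (frame_pairing_formula). *)

(** * The trace inner product and orthogonal matrices *)

Section Inner.
Context {R : realType}.

Lemma innerE p q (A B : 'M[R]_(p, q)) :
  inner A B = \sum_i \sum_j A i j * B i j.
Proof.
rewrite /inner /mxtrace exchange_big /=; apply: eq_bigr => j _.
by rewrite mxE; apply: eq_bigr => i _; rewrite mxE.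
Qed.

Lemma innerC p q (A B : 'M[R]_(p, q)) : inner A B = inner B A.
Proof.
by rewrite !innerE; apply: eq_bigr => i _; apply: eq_bigr => j _; rewrite mulrC.
Qed.

Lemma innerDr p q (A B C : 'M[R]_(p, q)) :
  inner A (B + C) = inner A B + inner A C.
Proof. by rewrite /inner mulmxDr mxtraceD. Qed.

Lemma innerNr p q (A B : 'M[R]_(p, q)) : inner A (- B) = - inner A B.
Proof. by rewrite /inner mulmxN linearN. Qed.

Lemma innerZr p q (A B : 'M[R]_(p, q)) c : inner A (c *: B) = c * inner A B.
Proof. by rewrite /inner -scalemxAr linearZ. Qed.

Lemma innerDl p q (A B C : 'M[R]_(p, q)) :
  inner (B + C) A = inner B A + inner C A.
Proof. by rewrite !(innerC _ A) innerDr. Qed.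

Lemma innerNl p q (A B : 'M[R]_(p, q)) : inner (- B) A = - inner B A.
Proof. by rewrite !(innerC _ A) innerNr. Qed.

Lemma innerZl p q (A B : 'M[R]_(p, q)) c : inner (c *: B) A = c * inner B A.
Proof. by rewrite !(innerC _ A) innerZr. Qed.

Definition inner_lin := (innerDl, innerDr, innerNl, innerNr, innerZl, innerZr).

Lemma inner_suml p q (I : finType) (A : 'M[R]_(p, q)) (B : I -> 'M[R]_(p, q)) :
  inner (\sum_i B i) A = \sum_i inner (B i) A.
Proof.
elim/big_rec2: _ => [|i a b _ <-]; last by rewrite innerDl.
by rewrite innerE big1 // => i _; rewrite big1 // => j _; rewrite mxE mul0r.
Qed.

Lemma inner_sumr p q (I : finType) (A : 'M[R]_(p, q)) (B : I -> 'M[R]_(p, q)) :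
  inner A (\sum_i B i) = \sum_i inner A (B i).
Proof. by rewrite innerC inner_suml; under eq_bigr do rewrite innerC. Qed.

Lemma inner_mull p q r (P : 'M[R]_(p, q)) (A : 'M[R]_(q, r)) B :
  inner (P *m A) B = inner A (P^T *m B).
Proof. by rewrite /inner trmx_mul mulmxA. Qed.

Lemma inner_mulr p q r (A : 'M[R]_(p, q)) (Q : 'M[R]_(q, r)) B :
  inner (A *m Q) B = inner A (B *m Q^T).
Proof. by rewrite /inner trmx_mul mxtrace_mulC mulmxA mxtrace_mulC mulmxA. Qed.

Lemma inner_tr p q (A B : 'M[R]_(p, q)) : inner (A^T) (B^T) = inner A B.
Proof. by rewrite /inner trmxK -mxtrace_tr trmx_mul trmxK mxtrace_mulC. Qed.

Lemma inner_ge0 p q (A : 'M[R]_(p, q)) : 0 <= inner A A.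
Proof.
by rewrite innerE; do 2 apply: sumr_ge0 => ? _; rewrite -expr2 sqr_ge0.
Qed.

Lemma inner_le0_eq0 p q (A : 'M[R]_(p, q)) : inner A A <= 0 -> A = 0.
Proof.
move=> A0; have /eqP : inner A A = 0 by apply/eqP; rewrite eq_le A0 inner_ge0.
rewrite innerE psumr_eq0 => [/allP h|i _]; last first.
  by apply: sumr_ge0 => j _; rewrite -expr2 sqr_ge0.
apply/matrixP => i j; rewrite mxE; have /implyP := h i (mem_index_enum i).
move=> /(_ isT); rewrite psumr_eq0 => [/allP /(_ j (mem_index_enum j))|k _].
  by rewrite /= mulf_eq0 orbb => /eqP.
by rewrite -expr2 sqr_ge0.
Qed.

Lemma inner_skew_sym p (A S : 'M[R]_p) : A^T = - A -> S^T = S -> inner A S = 0.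
Proof.
move=> hA hS; have := inner_tr A S; rewrite hA hS innerNl => h; lra.
Qed.

End Inner.

Section Orthogonal.
Context {R : realType}.

Lemma orthE k (U : 'M[R]_k) : orthogonal_mx U -> U^T *m U = 1%:M.
Proof. by []. Qed.

Lemma orthE' k (U : 'M[R]_k) : orthogonal_mx U -> U *m U^T = 1%:M.
Proof. by move/mulmx1C. Qed.

Lemma orth1 k : orthogonal_mx (1%:M : 'M[R]_k).
Proof. by rewrite /orthogonal_mx trmx1 mulmx1. Qed.

Lemma orth_tr k (U : 'M[R]_k) : orthogonal_mx U -> orthogonal_mx U^T.
Proof. by rewrite /orthogonal_mx trmxK => /mulmx1C. Qed.

Lemma orth_mul k (U V : 'M[R]_k) :
  orthogonal_mx U -> orthogonal_mx V -> orthogonal_mx (U *m V).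
Proof.
move=> hU hV; rewrite /orthogonal_mx trmx_mul mulmxA -(mulmxA V^T).
by rewrite (orthE hU) mulmx1 (orthE hV).
Qed.

Lemma inner_orth p q (U : 'M[R]_p) (V : 'M[R]_q) (A B : 'M[R]_(p, q)) :
  orthogonal_mx U -> orthogonal_mx V ->
  inner (U *m A *m V^T) (U *m B *m V^T) = inner A B.
Proof.
move=> hU hV; rewrite inner_mulr trmxK -2!mulmxA (orthE hV) mulmx1.
by rewrite inner_mull mulmxA (orthE hU) mul1mx.
Qed.

Lemma orth_row_sum k (U : 'M[R]_k) i :
  orthogonal_mx U -> \sum_j U i j ^+ 2 = 1.
Proof.
move=> /orthE' /matrixP /(_ i i); rewrite !mxE eqxx mulr1n => <-.
by apply: eq_bigr => j _; rewrite mxE.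
Qed.

Lemma orth_col_sum k (U : 'M[R]_k) j :
  orthogonal_mx U -> \sum_i U i j ^+ 2 = 1.
Proof.
move=> /orth_tr /(orth_row_sum j) <-.
by apply: eq_bigr => i _; rewrite mxE.
Qed.

Lemma orth_entry k (U : 'M[R]_k) i j : orthogonal_mx U -> `|U i j| <= 1.
Proof.
move=> /(orth_row_sum i) h; rewrite -(@expr_le1 _ 2) // real_normK ?num_real //.
rewrite -h (bigD1 j) //= lerDl; apply: sumr_ge0 => l _; exact: sqr_ge0.
Qed.

End Orthogonal.

(** * Rectangular diagonal matrices and von Neumann's trace inequality *)

Definition dg {R : realType} m {n} (v : 'cV[R]_n) : 'M[R]_(m, n) :=
  \matrix_(i, j) (v j 0 *+ (i == j :> nat)).

Definition ordered_nonneg {R : realType} n (v : 'cV[R]_n) : Prop :=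
  (forall i, 0 <= v i 0) /\ (forall i j : 'I_n, (i <= j)%N -> v j 0 <= v i 0).

Section Dg.
Context {R : realType} {m n : nat}.
Implicit Types v w : 'cV[R]_n.

Lemma dgE v i j : dg m v i j = v j 0 *+ (i == j :> nat).
Proof. by rewrite mxE. Qed.

Lemma dgD v w : dg m (v + w) = dg m v + dg m w.
Proof. by apply/matrixP => i j; rewrite !mxE mulrnDl. Qed.

Lemma dgZ c v : dg m (c *: v) = c *: dg m v.
Proof. by apply/matrixP => i j; rewrite !mxE mulrnAr. Qed.

Lemma dgN v : dg m (- v) = - dg m v.
Proof. by apply/matrixP => i j; rewrite !mxE mulNrn. Qed.

Lemma dgB v w : dg m (v - w) = dg m v - dg m w.
Proof. by rewrite dgD dgN. Qed.

Lemma ordered_nonneg0 : ordered_nonneg (0 : 'cV[R]_n).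
Proof. by split => [i|i j _]; rewrite !mxE. Qed.

Lemma ordered_nonnegD v w :
  ordered_nonneg v -> ordered_nonneg w -> ordered_nonneg (v + w).
Proof.
move=> [v0 vi] [w0 wi]; split=> [i|i j ij]; rewrite !mxE; first exact: addr_ge0.
by rewrite lerD ?vi ?wi.
Qed.

Lemma dg_trmul v w (hnm : (n <= m)%N) (i j : 'I_n) :
  ((dg m v)^T *m dg m w) i j = v i 0 * w i 0 *+ (i == j).
Proof.
rewrite mxE (bigD1 (widen_ord hnm i)) //= big1 ?addr0 => [|k ki].
  rewrite !mxE /= eqxx mulr1n mulrnAr -val_eqE /=.
  by case: eqP => // /val_inj ->.
by rewrite !mxE; have [e|] := eqVneq (k : nat) i;
  [case/eqP: ki; apply: val_inj|rewrite mulr0n mul0r].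
Qed.

Lemma inner_dg v w (hnm : (n <= m)%N) : inner (dg m v) (dg m w) = inner v w.
Proof.
rewrite /inner /mxtrace big_ord1 mxE; apply: eq_bigr => i _.
by rewrite (dg_trmul _ _ hnm) eqxx mxE.
Qed.

Lemma inner_cV v w : inner v w = \sum_i v i 0 * w i 0.
Proof. by rewrite innerE; apply: eq_bigr => i _; rewrite big_ord1. Qed.

End Dg.

Section Abel.
Context {R : realType}.

(** Abel summation, by induction on n in the stronger form that the sum is at
    least the last weight times the total of u. *)
Lemma abel_ge0_nat (a u : nat -> R) n :
  (forall i, 0 <= a i) -> (forall i, a i.+1 <= a i) ->
  (forall k, (k < n)%N -> 0 <= \sum_(i < k.+1) u i) ->
  0 <= \sum_(i < n) a i * u i.
Proof.
move=> a0 ai; case: n => [|n] hS; first by rewrite big_ord0.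
suff h : a n * (\sum_(i < n.+1) u i) <= \sum_(i < n.+1) a i * u i.
  by apply: le_trans h; rewrite mulr_ge0 ?hS.
elim: n hS => [|n IH] hS; first by rewrite !big_ord1.
rewrite big_ord_recr mulrDr [leRHS]big_ord_recr /= lerD2r.
apply: le_trans (IH _) => [|k kn]; first by rewrite ler_wpM2r ?hS.
by apply: hS; exact: ltnW.
Qed.

Lemma abel_ge0 n (a : 'cV[R]_n) (u : 'I_n -> R) : ordered_nonneg a ->
  (forall k : 'I_n, 0 <= \sum_(i < n | (i <= k)%N) u i) ->
  0 <= \sum_i a i 0 * u i.
Proof.
move=> [a0 ai] hS.
pose ext (b : 'I_n -> R) k := if insub k is Some i then b i else 0.
have extE b (i : 'I_n) : ext b i = b i by rewrite /ext valK.
rewrite (eq_bigr (fun i : 'I_n => ext (a^~ 0) i * ext u i)) => [|i _]; last first.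
  by rewrite !extE.
apply: (abel_ge0_nat (a := ext (a^~ 0)) (u := ext u)) => [i|i|k kn].
- by rewrite /ext; case: insubP.
- rewrite /ext; case: insubP => [j _ ej|_]; case: insubP => [k kn ek|] //.
    by apply: ai; rewrite ej ek leqnSn.
  by move=> kn; have := ltn_ord j; rewrite ej => /ltnW; rewrite (negPf kn).
have := hS (Ordinal kn); rewrite (big_ord_widen_cond n xpredT (ext u) kn) /=.
rewrite (eq_bigl (fun i : 'I_n => (i <= k)%N)) => [|i] //.
by under eq_bigr do rewrite -extE.
Qed.

(** Abel summation in each variable reduces this to the indicator vectors of
    initial segments, where it says that the entries of a k x l corner of c sum to
    at most min(k, l). *)
Lemma substochastic_le n (a b : 'cV[R]_n) (c : 'I_n -> 'I_n -> R) :
  ordered_nonneg a -> ordered_nonneg b -> (forall i j, 0 <= c i j) ->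
  (forall i, \sum_j c i j <= 1) -> (forall j, \sum_i c i j <= 1) ->
  \sum_i \sum_j a i 0 * b j 0 * c i j <= inner a b.
Proof.
move=> ha hb c0 cr cc; rewrite inner_cV -subr_ge0 -sumrB.
pose d (i j : 'I_n) := (i == j)%:R - c i j.
rewrite (eq_bigr (fun i => a i 0 * \sum_j b j 0 * d i j)) => [|i _]; last first.
  rewrite /d; under [in RHS]eq_bigr do rewrite mulrBr.
  rewrite sumrB mulrBr mulr_sumr; congr (_ - _); last first.
    by rewrite mulr_sumr; apply: eq_bigr => j _; rewrite mulrA.
  rewrite (bigD1 i) //= eqxx mulr1 big1 ?addr0 // => j /negPf.
  by rewrite eq_sym => ->; rewrite !mulr0.
apply: abel_ge0 => // k; rewrite exchange_big /=.
rewrite (eq_bigr (fun j => b j 0 * \sum_(i < n | (i <= k)%N) d i j)) => [|j _];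
  last by rewrite mulr_sumr.
apply: abel_ge0 => // l.
have sub_le (f : 'I_n -> R) (P : pred 'I_n) : (forall i, 0 <= f i) ->
    \sum_i f i <= 1 -> \sum_(i | P i) f i <= 1.
  move=> f0; apply: le_trans; rewrite [leRHS](bigID P) /= lerDl.
  exact: sumr_ge0.
have one (P : pred 'I_n) i : P i -> \sum_(j | P j) (i == j)%:R = 1 :> R.
  move=> Pi; rewrite (bigD1 i) //= eqxx big1 ?addr0 // => j /andP[_ /negPf].
  by rewrite eq_sym => ->.
have [kl|lk] := leqP k l.
  rewrite exchange_big /=; apply: sumr_ge0 => i ik; rewrite sumrB.
  by rewrite one ?(leq_trans ik) // subr_ge0 sub_le.
apply: sumr_ge0 => j jl; rewrite sumrB.
under eq_bigr do rewrite eq_sym.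
by rewrite one ?(leq_trans jl) ?(ltnW lk) // subr_ge0 (sub_le (c^~ j)).
Qed.

(** Expanding the product gives the sum of a_i b_l P_il Q_il, and P_il Q_il is at
    most the mean of P_il^2 and Q_il^2, which is a substochastic matrix. *)
Lemma von_neumann_diag m n (hnm : (n <= m)%N) (a b : 'cV[R]_n)
    (P : 'M[R]_m) (Q : 'M[R]_n) :
  ordered_nonneg a -> ordered_nonneg b ->
  orthogonal_mx P -> orthogonal_mx Q ->
  inner (dg m a) (P *m dg m b *m Q^T) <= inner a b.
Proof.
move=> ha hb hP hQ; pose w := widen_ord hnm.
have PbQ (i j : 'I_n) : (P *m dg m b *m Q^T) (w i) j
    = \sum_l P (w i) (w l) * b l 0 * Q j l.
  rewrite mxE; apply: eq_bigr => l _; rewrite !mxE; congr (_ * _).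
  rewrite (bigD1 (w l)) //= big1 => [|k kl]; first by rewrite mxE eqxx addr0.
  rewrite mxE; case: eqVneq => [e|]; last by rewrite mulr0.
  by case/eqP: kl; apply: val_inj.
have -> : inner (dg m a) (P *m dg m b *m Q^T) =
    \sum_i a i 0 * \sum_l P (w i) (w l) * b l 0 * Q i l.
  rewrite innerE exchange_big; apply: eq_bigr => j _.
  rewrite (bigD1 (w j)) //= big1 => [|k kl]; last first.
    rewrite mxE; case: eqVneq => [e|]; last by rewrite mul0r.
    by case/eqP: kl; apply: val_inj.
  by rewrite PbQ mxE eqxx addr0.
have sP k : \sum_l P (w k) (w l) ^+ 2 <= 1.
  rewrite -(orth_row_sum (w k) hP).
  rewrite [leRHS](bigID (fun i : 'I_m => (i < n)%N)) /= big_ord_narrow lerDl.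
  by apply: sumr_ge0 => l _; exact: sqr_ge0.
have sP' k : \sum_l P (w l) (w k) ^+ 2 <= 1.
  rewrite -(orth_col_sum (w k) hP).
  rewrite [leRHS](bigID (fun i : 'I_m => (i < n)%N)) /= big_ord_narrow lerDl.
  by apply: sumr_ge0 => l _; exact: sqr_ge0.
pose c i j := 2^-1 * (P (w i) (w j) ^+ 2 + Q i j ^+ 2).
apply: le_trans (substochastic_le (c := c) ha hb _ _ _) => [|i j|i|j].
- apply: ler_sum => i _; rewrite mulr_sumr; apply: ler_sum => j _.
  have ab0 : 0 <= a i 0 * b j 0 by rewrite mulr_ge0 ?(ha.1, hb.1).
  have -> : a i 0 * (P (w i) (w j) * b j 0 * Q i j) =
    a i 0 * b j 0 * (P (w i) (w j) * Q i j) by ring.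
  rewrite ler_wpM2l // /c; have := sqr_ge0 (P (w i) (w j) - Q i j); nra.
- by rewrite /c mulr_ge0 ?addr_ge0 ?sqr_ge0.
- rewrite /c -mulr_sumr big_split /= (orth_row_sum i hQ).
  have := sP i; lra.
- rewrite /c -mulr_sumr big_split /= (orth_col_sum j hQ).
  have := sP' j; lra.
Qed.

End Abel.

(** * Singular values *)

Lemma char_poly_orth {R : realType} n (V M : 'M[R]_n) : orthogonal_mx V ->
  char_poly (V *m M *m V^T) = char_poly M.
Proof.
move=> hV; pose W := map_mx polyC V; pose W' := map_mx polyC V^T.
have WW : W *m W' = 1%:M by rewrite -map_mxM /= (orthE' hV) map_mx1.
have E : char_poly_mx (V *m M *m V^T) = W *m char_poly_mx M *m W'.
  rewrite /char_poly_mx mulmxBr mulmxBl !map_mxM -/W -/W'; congr (_ - _).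
  by rewrite scalar_mxC -mulmxA WW mulmx1.
by rewrite /char_poly E !det_mulmx mulrAC -det_mulmx WW det1 mul1r.
Qed.

(** A sealed name for sing_vals: it is selected by a choice operator, and
    everything below rests on its characterization svalsP alone. *)
HB.lock Definition svals {R : realType} {m n} (X : 'M[R]_(m, n)) : 'cV[R]_n :=
  sing_vals X.

Lemma sing_valsE {R : realType} m n (Z : 'M[R]_(m, n)) : sing_vals Z = svals Z.
Proof. by rewrite svals.unlock. Qed.

Section SingularValueLemmas.
Context {R : realType} {m n : nat}.
Implicit Types (X : 'M[R]_(m, n)) (v w : 'cV[R]_n).

Lemma svalsP X : is_sing_vals X (svals X).
Proof. by rewrite svals.unlock; exact: sing_valsP. Qed.

Lemma Sigma_dg X : Sigma X = dg m (svals X).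
Proof. by rewrite svals.unlock. Qed.

Lemma sing_vals_ordered X : ordered_nonneg (svals X).
Proof. by have [] := svalsP X. Qed.

(** Vectors whose squares are the roots of the same polynomial agree up to a
    permutation and signs. *)
Lemma squares_perm v w :
  \prod_(i < n) ('X - (v i 0 ^+ 2)%:P) = \prod_(i < n) ('X - (w i 0 ^+ 2)%:P) ->
  exists s : 'S_n, forall i, v i 0 ^+ 2 = w (s i) 0 ^+ 2.
Proof.
move=> E; pose sq (u : 'cV[R]_n) := [tuple u i 0 ^+ 2 | i < n].
have prodE (u : 'cV[R]_n) : \prod_(i < n) ('X - (u i 0 ^+ 2)%:P) =
    \prod_(x <- sq u) ('X - x%:P).
  by rewrite big_tuple; apply: eq_bigr => i _; rewrite tnth_mktuple.
have /tuple_permP [s hs] : perm_eq (sq v) (sq w).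
  by apply: prod_XsubC_eq; rewrite -!prodE.
exists s => i; have /val_inj /(congr1 (fun t => tnth t i)) := hs.
by rewrite !tnth_mktuple.
Qed.

Lemma sing_vals_eq X v : is_sing_vals X v -> svals X = v.
Proof.
case=> v0 vi Ev; have [s0 si Es] := svalsP X.
have {Ev Es} := esym (etrans (esym Ev) Es); set s := svals X => E.
pose sq (u : 'cV[R]_n) := [seq u i 0 ^+ 2 | i : 'I_n].
have prodE (u : 'cV[R]_n) : \prod_(i < n) ('X - (u i 0 ^+ 2)%:P) =
    \prod_(x <- sq u) ('X - x%:P).
  by rewrite big_map big_enum.
have szE u : size (sq u) = n by rewrite size_map size_enum_ord.
have nthE (u : 'cV[R]_n) (i : 'I_n) : nth 0 (sq u) i = u i 0 ^+ 2.
  by rewrite (nth_map i) ?size_enum_ord // nth_ord_enum.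
have sortedE u : ordered_nonneg u -> sorted >=%R (sq u).
  case=> u0 ui; apply/(sortedP 0) => i; rewrite szE => i1.
  have /= -> := nthE u (Ordinal (ltnW i1)); have /= -> := nthE u (Ordinal i1).
  by rewrite lerXn2r ?nnegrE ?u0 //; apply: ui => /=.
have pE : perm_eq (sq s) (sq v) by apply: prod_XsubC_eq; rewrite -!prodE.
have sqE : sq s = sq v.
  apply: (sorted_eq ge_trans) pE; try exact: sortedE.
  by move=> x y /andP[yx xy]; apply/le_anti/andP.
apply/colP => i; have /eqP := nthE s i.
rewrite sqE nthE eq_sym eqrXn2 ?v0 ?s0 //.
by move/eqP.
Qed.

Lemma sing_vals_orth X (U : 'M[R]_m) (V : 'M[R]_n) :
  orthogonal_mx U -> orthogonal_mx V ->
  svals (U *m X *m V^T) = svals X.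
Proof.
move=> hU hV; apply: sing_vals_eq; have [s0 si Es] := svalsP X; split => //.
rewrite -Es !trmx_mul trmxK -(char_poly_orth (X^T *m X) hV); congr char_poly.
by rewrite !mulmxA -(mulmxA _ U^T) (orthE hU) mulmx1.
Qed.

Lemma char_poly_dg v (hnm : (n <= m)%N) :
  char_poly ((dg m v)^T *m dg m v) = \prod_(i < n) ('X - (v i 0 ^+ 2)%:P).
Proof.
rewrite char_poly_trig; last first.
  apply/is_trig_mxP => i j ij; rewrite dg_trmul //.
  by rewrite -val_eqE /= ltn_eqF // mulr0n.
by apply: eq_bigr => i _; rewrite dg_trmul // eqxx mulr1n expr2.
Qed.

Lemma sing_vals_dg v (hnm : (n <= m)%N) :
  ordered_nonneg v -> svals (dg m v) = v.
Proof.
by case=> v0 vi; apply: sing_vals_eq; split => //; rewrite char_poly_dg.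
Qed.

(** The singular values of a rectangular diagonal matrix are, up to signs, a
    permutation of its diagonal, whatever the order and signs of the latter. *)
Lemma abs_sym_dg (f : 'cV[R]_n -> \bar R) v (hnm : (n <= m)%N) :
  absolutely_symmetric f -> f (svals (dg m v)) = f v.
Proof.
move=> fsym; have [s0 _] := svalsP (dg m v).
rewrite char_poly_dg // => /esym /squares_perm [s hs].
pose e i := v (s i) 0 < 0.
rewrite -(fsym v (diag_mx (\row_i (-1) ^+ e i) *m perm_mx s)); last first.
  by exists s, e.
congr f; apply/colP => i.
rewrite -mulmxA mul_diag_mx !mxE (bigD1 (s i)) //= big1 => [|j /negPf sj].
  rewrite !mxE eqxx mul1r addr0.
  have /eqP := hs i; rewrite eqf_sqr => /orP[] /eqP; rewrite /e.
    move=> vE; have := s0 i; rewrite vE leNgt.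
    by case: (_ < 0) => // _; rewrite mul1r.
  move=> vE; have := s0 i; rewrite vE oppr_ge0 le_eqVlt.
  case/orP => [/eqP->|->]; first by rewrite oppr0 mulr0.
  by rewrite mulN1r.
by rewrite !mxE eq_sym sj mul0r.
Qed.

End SingularValueLemmas.

(** * Convergence of matrices and second-order expansions *)

Section MatrixConvergence.
Context {R : realType} {T : Type} (F : set_system T) {FF : Filter F}.

Lemma cvg_entryP p q (f : T -> 'M[R]_(p, q)) (M : 'M[R]_(p, q)) :
  f @ F --> M <-> forall i j, f t i j @[t --> F] --> M i j.
Proof.
split=> [fM i j|fM A [P MP PA]].
  have h := @coord_continuous R p q i j M.
  exact (cvg_comp _ _ fM h).
suff : \forall t \near F, forall i j, P i j (f t i j).
  by apply: filterS => t Pt; apply: PA.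
by do 2 (apply: filter_forall => ?); apply: fM; exact: MP.
Qed.

Lemma cvg_mulmx p q r (f : T -> 'M[R]_(p, q)) (g : T -> 'M[R]_(q, r))
    (A : 'M[R]_(p, q)) (B : 'M[R]_(q, r)) :
  f @ F --> A -> g @ F --> B -> f t *m g t @[t --> F] --> A *m B.
Proof.
move=> /cvg_entryP fA /cvg_entryP gB; apply/cvg_entryP => i j.
under eq_fun do rewrite mxE; rewrite mxE.
by apply: cvg_big => [|k _]; [exact: add_continuous|exact: cvgM].
Qed.

Lemma cvg_trmx p q (f : T -> 'M[R]_(p, q)) (A : 'M[R]_(p, q)) :
  f @ F --> A -> (f t)^T @[t --> F] --> A^T.
Proof.
move=> /cvg_entryP fA; apply/cvg_entryP => i j.
under eq_fun do rewrite mxE; rewrite mxE; exact: fA.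
Qed.

Lemma cvg_mxtrace p (f : T -> 'M[R]_p) (A : 'M[R]_p) :
  f @ F --> A -> \tr (f t) @[t --> F] --> \tr A.
Proof.
move=> /cvg_entryP fA; rewrite /mxtrace.
by apply: cvg_big => [|k _]; [exact: add_continuous|exact: fA].
Qed.

Lemma cvg_inner p q (f g : T -> 'M[R]_(p, q)) (A B : 'M[R]_(p, q)) :
  f @ F --> A -> g @ F --> B -> inner (f t) (g t) @[t --> F] --> inner A B.
Proof.
by move=> fA gB; apply: cvg_mxtrace; apply: cvg_mulmx => //; exact: cvg_trmx.
Qed.

Lemma cvg_dg m n (f : T -> 'cV[R]_n) (v : 'cV[R]_n) :
  f @ F --> v -> dg m (f t) @[t --> F] --> dg m v.
Proof.
move=> /cvg_entryP fv; apply/cvg_entryP => i j.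
under eq_fun do rewrite mxE; rewrite mxE.
by case: (i == j :> nat); [exact: fv|exact: cvg_cst].
Qed.

End MatrixConvergence.

Section Expansions.
Context {R : realType} {T : Type} (F : set_system T) (FF : Filter F).
Variables (tau : T -> R).
Hypothesis tau0 : tau @ F --> (0 : R).

(** Expansion to second order along F in the real parameter tau; the quadratic
    coefficient is allowed to depend on the point and only has to converge. *)
Definition expands2 p q (f : T -> 'M[R]_(p, q))
    (A0 A1 A2 : 'M[R]_(p, q)) :=
  exists2 r : T -> 'M[R]_(p, q), r @ F --> A2 &
    forall t, f t = A0 + tau t *: A1 + tau t ^+ 2 *: r t.

Lemma expands2_cst p q (A : 'M[R]_(p, q)) : expands2 (fun=> A) A 0 0.
Proof.
by exists (fun=> 0) => [|t]; [exact: cvg_cst|rewrite !scaler0 !addr0].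
Qed.

Lemma expands2_tr p q (f : T -> 'M[R]_(p, q)) A0 A1 A2 :
  expands2 f A0 A1 A2 -> expands2 (fun t => (f t)^T) A0^T A1^T A2^T.
Proof.
case=> r rA fE; exists (fun t => (r t)^T) => [|t]; first exact: cvg_trmx.
by rewrite fE !linearD !linearZ.
Qed.

Lemma expands2_mul p q s (f : T -> 'M[R]_(p, q)) (g : T -> 'M[R]_(q, s))
    A0 A1 A2 B0 B1 B2 :
  expands2 f A0 A1 A2 -> expands2 g B0 B1 B2 ->
  expands2 (fun t => f t *m g t) (A0 *m B0) (A0 *m B1 + A1 *m B0)
    (A0 *m B2 + A1 *m B1 + A2 *m B0).
Proof.
move=> [r rA fE] [h hB gE].
exists (fun t => A0 *m h t + (A1 *m B1 + tau t *: (A1 *m h t)) +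
    (r t *m B0 + tau t *: (r t *m B1) + tau t ^+ 2 *: (r t *m h t))) => [|t].
  have tau2 : tau t ^+ 2 @[t --> F] --> (0 : R).
    by rewrite -[X in _ --> X](mulr0 0); apply: cvgM.
  have cZ a b (u : T -> R) (k : T -> 'M[R]_(a, b)) K :
      u @ F --> (0 : R) -> k @ F --> (K : 'M[R]_(a, b)) -> u t *: k t @[t --> F] --> (0 : 'M[R]_(a, b)).
    by move=> u0 kK; rewrite -(scale0r K); exact: cvgZ.
  have Ah : A1 *m h t @[t --> F] --> A1 *m B2 by apply: cvg_mulmx => //; exact: cvg_cst.
  have rB : r t *m B1 @[t --> F] --> A2 *m B1 by apply: cvg_mulmx => //; exact: cvg_cst.
  have rh : r t *m h t @[t --> F] --> A2 *m B2 by exact: cvg_mulmx.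
  apply: cvgD; last first.
    rewrite -[X in _ --> X]addr0; apply: cvgD; last exact: (cZ _ _ _ _ _ tau2 rh).
    rewrite -[X in _ --> X]addr0; apply: cvgD; last exact: (cZ _ _ _ _ _ tau0 rB).
    by apply: cvg_mulmx => //; exact: cvg_cst.
  apply: cvgD; first by apply: cvg_mulmx => //; exact: cvg_cst.
  rewrite -[X in _ --> X]addr0; apply: cvgD; last exact: (cZ _ _ _ _ _ tau0 Ah).
  exact: cvg_cst.
rewrite fE gE !(mulmxDl, mulmxDr) -!scalemxAl -!scalemxAr.
move: (_ *m _) (_ *m _) (_ *m _) (_ *m _) (_ *m _) (_ *m _) => a b c d e k.
move: (_ *m _) (_ *m _) (_ *m _) => a' b' c'.
by apply/matrixP => i j; rewrite !mxE; ring.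
Qed.

End Expansions.

(** * The Cayley transform of a skew-symmetric matrix *)

(** A rational substitute for the exponential of 2S: orthogonal for
    skew-symmetric S, and with the same expansion to second order. *)
Definition cayley {R : realType} n (S : 'M[R]_n) : 'M[R]_n :=
  invmx (1%:M - S) *m (1%:M + S).

Section Cayley.
Context {R : realType} {n : nat}.
Implicit Types A S : 'M[R]_n.

Lemma skew_unit S : S^T = - S -> (1%:M - S) \in unitmx.
Proof.
move=> hS; rewrite -row_free_unit -kermx_eq0; apply/eqP/row_matrixP => i.
set v := row i _; rewrite row0.
have : v *m (1%:M - S) = 0 by rewrite /v -row_mul mulmx_ker row0.
rewrite mulmxBr mulmx1 => /eqP; rewrite subr_eq0 => /eqP vS.
have := inner_mulr v S v; rewrite hS -vS mulmxN -vS innerNr => h.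
apply: inner_le0_eq0; lra.
Qed.

Lemma invmx_1B S : S^T = - S ->
  invmx (1%:M - S) = 2^-1 *: (cayley S + 1%:M).
Proof.
move=> hS.
have -> : cayley S + 1%:M = invmx (1%:M - S) *m (1%:M + S + (1%:M - S)).
  by rewrite mulmxDr mulVmx // skew_unit.
have -> : 1%:M + S + (1%:M - S) = 2 *: 1%:M.
  by apply/matrixP => i j; rewrite !mxE; ring.
by rewrite -scalemxAr mulmx1 scalerA mulVf ?scale1r.
Qed.

Lemma cayleyE S : S^T = - S ->
  cayley S = 1%:M + 2 *: S + 2 *: (S *m S *m invmx (1%:M - S)).
Proof.
move=> hS; set Q := invmx _.
have QE : Q = 1%:M + S *m Q.
  have := mulmxV (skew_unit hS); rewrite -/Q mulmxBl mul1mx => /eqP.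
  by rewrite subr_eq => /eqP.
have -> : cayley S = 2 *: Q - 1%:M.
  by rewrite /Q invmx_1B // scalerA divff // scale1r addrK.
rewrite {1}QE {1}QE mulmxDr mulmx1 mulmxA !scalerDr.
by apply/matrixP => i j; rewrite !mxE; ring.
Qed.

Lemma cayley_orth S : S^T = - S -> orthogonal_mx (cayley S).
Proof.
move=> hS; have hN : (- S)^T = - - S by rewrite linearN /= hS.
have uM := skew_unit hS; have := skew_unit hN; rewrite opprK => uN.
have tN : (1%:M + S)^T = 1%:M - S by rewrite linearD /= trmx1 hS.
have tM : (1%:M - S)^T = 1%:M + S by rewrite linearB /= trmx1 hS opprK.
rewrite /orthogonal_mx /cayley trmx_mul trmx_inv tN tM.
have NM : invmx (1%:M - S) *m (1%:M + S) = (1%:M + S) *m invmx (1%:M - S).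
  apply: (canRL (mulmxK uM)); rewrite -mulmxA.
  have -> : (1%:M + S) *m (1%:M - S) = (1%:M - S) *m (1%:M + S).
    rewrite !(mulmxDl, mulmxDr, mul1mx, mulmx1, mulNmx, mulmxN) -!addrA.
    by congr (_ + _); rewrite addrC -addrA; congr (_ + _); rewrite addrC.
  by rewrite mulmxA mulVmx // mul1mx.
by rewrite NM !mulmxA mulmxKV // mulmxV.
Qed.

End Cayley.

Section CayleyCurve.
Context {R : realType} {n : nat}.
Implicit Types A S : 'M[R]_n.

Lemma cayley_intertwine p S (T : 'M[R]_p) (D : 'M[R]_(n, p)) :
  S^T = - S -> T^T = - T -> S *m D = D *m T ->
  cayley S *m D = D *m cayley T.
Proof.
move=> hS hT SD; have uS := skew_unit hS; have uT := skew_unit hT.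
have DN : (1%:M + S) *m D = D *m (1%:M + T).
  by rewrite mulmxDl mulmxDr mul1mx mulmx1 SD.
rewrite /cayley -mulmxA DN mulmxA [RHS]mulmxA; congr (_ *m _).
apply: (canRL (mulmxK uT)); rewrite -mulmxA.
have -> : D *m (1%:M - T) = (1%:M - S) *m D.
  by rewrite mulmxBl mulmxBr mul1mx mulmx1 SD.
by rewrite mulmxA mulVmx // mul1mx.
Qed.

(** The resolvent Q in the remainder is (C + 1)/2 with C orthogonal, so its
    entries are bounded by 1; then Q = 1 + SQ forces Q to tend to 1 with S. *)
Lemma expands2_cayley {T : Type} (F : set_system T) (FF : Filter F)
    (tau : T -> R) A :
  tau @ F --> (0 : R) -> A^T = - A ->
  expands2 F tau (fun t => cayley ((2^-1 * tau t) *: A)) 1%:M A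
    (2^-1 *: (A *m A)).
Proof.
move=> tau0 hA; pose S t := (2^-1 * tau t) *: A.
have hS t : (S t)^T = - S t by rewrite /S linearZ /= hA scalerN.
pose Q t := invmx (1%:M - S t).
have Qb t i j : `|Q t i j| <= 1.
  rewrite /Q invmx_1B // mxE.
  rewrite [X in _ * X]mxE [X in _ * (_ + X)]mxE; have := orth_entry i j (cayley_orth (hS t)).
  rewrite normrM [`|2^-1|]ger0_norm // => h.
  have : `|cayley (S t) i j + (i == j)%:R| <= 1 + 1.
    rewrite (le_trans (ler_normD _ _)) // lerD //.
    by case: (i == j); rewrite ?normr1 ?normr0.
  lra.
have QE t : Q t = 1%:M + S t *m Q t.
  have := mulmxV (skew_unit (hS t)); rewrite -/(Q t) mulmxBl mul1mx => /eqP.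
  by rewrite subr_eq => /eqP.
have Q1 : Q @ F --> (1%:M : 'M[R]_n).
  apply/cvg_entryP => i j; pose K := \sum_k `|A i k|.
  have dist t : `|Q t i j - (1%:M : 'M[R]_n) i j| <= `|tau t| * K.
    have -> : Q t i j - (1%:M : 'M[R]_n) i j = (S t *m Q t) i j.
      have /matrixP /(_ i j) := QE t; rewrite [RHS]mxE => ->; ring.
    rewrite /S -scalemxAl mxE normrM.
    rewrite normrM [`|2^-1|]ger0_norm // ler_pM ?mulr_ge0 //.
      by have := normr_ge0 (tau t); lra.
    rewrite mxE (le_trans (ler_norm_sum _ _ _)) // ler_sum // => k _.
    by rewrite normrM ler_piMr.
  have tK : `|tau t| * K @[t --> F] --> (0 : R).
    rewrite -(mul0r K); apply: cvgM; last exact: cvg_cst.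
    by rewrite -(@normr0 _ R); apply: cvg_norm.
  apply/subr_cvg0/norm_cvg0P; apply: squeeze_cvgr tK; last exact: cvg_cst.
  by near=> t; rewrite normr_ge0 dist.
exists (fun t => 2^-1 *: (A *m A *m Q t)) => [|t].
  rewrite -[A *m A in X in _ --> X]mulmx1; apply: cvgZ; first exact: cvg_cst.
  by apply: cvg_mulmx => //; exact: cvg_cst.
rewrite cayleyE // -/(S t) -/(Q t).
rewrite /S -!scalemxAl.
rewrite -!scalemxAr.
rewrite -!scalemxAl !scalerA.
by congr (_ + _ *: _ + _ *: _); field.
Unshelve. all: by end_near. Qed.

End CayleyCurve.

(** All arcs of matrices used below have this form: an arc N carried along the
    orbit of the orthogonal groups by the Cayley curves of A and B. *)
Lemma expands2_orbit {R : realType} {T : Type} (F : set_system T)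
    (FF : Filter F) (tau : T -> R) m n (A : 'M[R]_m) (B : 'M[R]_n) (N : T -> 'M[R]_(m, n))
    N0 N1 N2 :
  tau @ F --> (0 : R) -> A^T = - A -> B^T = - B -> expands2 F tau N N0 N1 N2 ->
  expands2 F tau
    (fun t => cayley ((2^-1 * tau t) *: A) *m N t
              *m (cayley ((2^-1 * tau t) *: B))^T)
    N0 (A *m N0 - N0 *m B + N1)
    (2^-1 *: (A *m A *m N0 - 2 *: (A *m N0 *m B) + N0 *m B *m B)
     + (A *m N1 - N1 *m B) + N2).
Proof.
move=> tau0 hA hB eN.
have eP := expands2_cayley FF tau0 hA.
have eQ := expands2_tr FF (expands2_cayley FF tau0 hB).
have := expands2_mul FF tau0 (expands2_mul FF tau0 eP eN) eQ.
have -> : (2^-1 *: (B *m B))^T = 2^-1 *: (B *m B).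
  by rewrite linearZ /= trmx_mul hB mulmxN mulNmx opprK.
rewrite trmx1 hB !mul1mx !mulmx1 !mulmxDl -!scalemxAl -!scalemxAr !mulmxN !mulmxA.
set L1 := (X in expands2 _ _ _ _ X) ; set L2 := (X in expands2 _ _ _ _ _ X).
set M1 := (X in _ -> expands2 _ _ _ _ X _); set M2 := (X in _ -> expands2 _ _ _ _ _ X).
have -> : M1 = L1 by rewrite /M1 /L1; apply/matrixP => i j; rewrite !mxE; ring.
suff -> : M2 = L2 by [].
rewrite /M2 /L2; move: (_ *m _) (_ *m _) (_ *m _) => a b c.
by apply/matrixP => i j; rewrite !mxE; field.
Qed.

(** * Simultaneous diagonalization and the singular value decomposition *)

Definition stabilizer {R : realType} {m n} (N : 'M[R]_(m, n)) :
    set ('M[R]_m * 'M[R]_n) :=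
  [set PQ | [/\ orthogonal_mx PQ.1, orthogonal_mx PQ.2 &
                PQ.1 *m N *m PQ.2^T = N]].

Lemma stabilizer_mul {R : realType} m n (N : 'M[R]_(m, n)) P Q C1 C2 :
  stabilizer N (P, Q) -> stabilizer N (C1, C2) ->
  stabilizer N (P *m C1, Q *m C2).
Proof.
case=> /= hP hQ hN [/= h1 h2 h]; split => /=; try exact: orth_mul.
by rewrite trmx_mul !mulmxA -2!(mulmxA P) h.
Qed.

(** The stabilizer is a closed subset of the compact set of orthogonal pairs. *)
Lemma stabilizer_argmax {R : realType} m n (N D M : 'M[R]_(m, n)) :
  exists P Q, stabilizer N (P, Q) /\
    forall P' Q', stabilizer N (P', Q') ->
      inner (P' *m D *m Q'^T) M <= inner (P *m D *m Q^T) M.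
Proof.
pose E := 'rV[R]_(m * m + n * n).
pose p (v : E) : 'M[R]_m := vec_mx (lsubmx v).
pose q (v : E) : 'M[R]_n := vec_mx (rsubmx v).
have pc (v : E) : p u @[u --> v] --> p v.
  apply/(cvg_entryP (F := nbhs v)) => i j; rewrite /p; under eq_fun do rewrite !mxE.
  by rewrite !mxE; exact: coord_continuous.
have qc (v : E) : q u @[u --> v] --> q v.
  apply/(cvg_entryP (F := nbhs v)) => i j; rewrite /q; under eq_fun do rewrite !mxE.
  by rewrite !mxE; exact: coord_continuous.
have pqc (N' : 'M[R]_(m, n)) (v : E) :
    p u *m N' *m (q u)^T @[u --> v] --> p v *m N' *m (q v)^T.
  have FF := nbhs_filter v; apply: cvg_mulmx; last exact: cvg_trmx (qc v).
  exact: cvg_mulmx (pc v) (cvg_cst N').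
have closed_eq k l (g : E -> 'M[R]_(k, l)) C : (forall v : E, g u @[u --> v] --> g v) ->
    closed [set v | g v = C].
  move=> gc; apply: (preimage_closed (f := g) (D := [set C])).
    by move=> v _; exact: gc.
  by apply: accessible_closed_set1; apply: hausdorff_accessible;
    exact: norm_hausdorff.
pose K := [set v : E | stabilizer N (p v, q v)].
have KE : K = [set v | (p v)^T *m p v = 1%:M] `&`
    ([set v | (q v)^T *m q v = 1%:M] `&` [set v | p v *m N *m (q v)^T = N]).
  by apply/seteqP; split => v; [case|case=> ? []].
have Kcl : closed K.
  rewrite KE; apply: closedI; [|apply: closedI]; apply: closed_eq => v.
  - exact: cvg_mulmx (cvg_trmx (pc v)) (pc v).
  - exact: cvg_mulmx (cvg_trmx (qc v)) (qc v).
  - exact: pqc.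
have Kbd : bounded_set K.
  exists 1; split => // b b1 v [/= hp hq _]; apply: le_trans (ltW b1).
  rewrite [leLHS]/Num.norm /= mx_normrE; apply/bigmax_leP; split=> //= -[i k] _ /=.
  rewrite ord1; case: (split_ordP k) => l ->.
    have -> : v 0 (lshift (n * n) l) = (lsubmx v) 0 l by rewrite mxE.
    case/mxvec_indexP: l => i' j'.
    by have := orth_entry i' j' hp; rewrite /p mxE.
  have -> : v 0 (rshift (m * m) l) = (rsubmx v) 0 l by rewrite mxE.
  case/mxvec_indexP: l => i' j'.
  by have := orth_entry i' j' hq; rewrite /q mxE.
have pqE P Q : exists v, p v = P /\ q v = Q.
  exists (row_mx (mxvec P) (mxvec Q)).
  by rewrite /p /q row_mxKl row_mxKr !mxvecK.
have K0 : K !=set0.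
  have [v [pv qv]] := pqE 1%:M 1%:M; exists v.
  by rewrite /K /= pv qv; split => /=; rewrite ?trmx1 ?mulmx1 ?mul1mx //; exact: orth1.
have fc : {within K, continuous (fun v => inner (p v *m D *m (q v)^T) M)}.
  apply: continuous_subspaceT => v.
  exact: cvg_inner (pqc D v) (cvg_cst M).
have [v] := compact_EVT_max K0 (bounded_closed_compact Kbd Kcl) fc.
rewrite inE => Kv hmax; exists (p v), (q v); split=> // P' Q' h'.
have [w [pw qw]] := pqE P' Q'; rewrite -pw -qw; apply: hmax.
by rewrite inE /K /= pw qw.
Qed.

(** The Cayley curves of A and B stay in the stabilizer, so the derivative of the
    pairing along them is nonpositive; so is its opposite, the derivative along
    the curves of - A and - B. *)
Lemma stabilizer_first_order {R : realType} m n (N D M : 'M[R]_(m, n)) A B :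
  (forall P Q, stabilizer N (P, Q) ->
    inner (P *m D *m Q^T) M <= inner D M) ->
  A^T = - A -> B^T = - B -> A *m N = N *m B ->
  inner (A *m D - D *m B) M = 0.
Proof.
move=> hmax; suff le0 A' B' : A'^T = - A' -> B'^T = - B' -> A' *m N = N *m B' ->
    inner (A' *m D - D *m B') M <= 0.
  move=> hA hB hN; apply/eqP; rewrite eq_le le0 //=.
  have hA' : (- A)^T = - - A by rewrite linearN /= hA.
  have hB' : (- B)^T = - - B by rewrite linearN /= hB.
  have hN' : - A *m N = N *m - B by rewrite mulNmx mulmxN hN.
  have := le0 _ _ hA' hB' hN'; rewrite mulNmx mulmxN -opprD innerNl.
  by rewrite oppr_le0.
move=> hA hB hN; pose F := (0 : R)^'+.
have tau0 : (fun t : R => t) @ F --> (0 : R) by apply: cvg_within.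
have FF : Filter F by exact: _.
have [r rc rE] := expands2_orbit FF tau0 hA hB (expands2_cst FF _ D).
set r0 := (X in r @ F --> X) in rc.
have c1 : - (t * inner (r t) M) @[t --> F] --> (0 : R).
  rewrite -[X in _ --> X]oppr0 -[X in - X](mul0r (inner r0 M)).
  by apply: cvgN; apply: cvgM => //; apply: cvg_inner => //; exact: cvg_cst.
pose L := inner (A' *m D - D *m B') M.
have c0 : (fun=> L) @ F --> L by exact: cvg_cst.
apply: (ler_cvg_to c0 c1).
have t_gt0 : \forall t \near F, 0 < t by exact: nbhs_right_gt.
near=> t; have tp : 0 < t by near: t.
  have S k (C : 'M[R]_k) : C^T = - C -> ((2^-1 * t) *: C)^T = - ((2^-1 * t) *: C).
    by move=> hC; rewrite linearZ /= hC scalerN.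
  have st : stabilizer N (cayley ((2^-1 * t) *: A'), cayley ((2^-1 * t) *: B')).
    split => /=; try by apply: cayley_orth; exact: S.
    rewrite (cayley_intertwine (T := (2^-1 * t) *: B')); try exact: S.
      by rewrite -mulmxA orthE' ?mulmx1 //; apply: cayley_orth; exact: S.
    by rewrite -scalemxAl -scalemxAr hN.
  have := hmax _ _ st; rewrite rE addr0 !inner_lin -addrA gerDl => h.
  have : t * (inner (A' *m D - D *m B') M + t * inner (r t) M) <= 0.
    by move: h; rewrite !inner_lin; nra.
  by rewrite pmulr_rle0 // -lerBrDr sub0r.
Unshelve. all: by end_near. Qed.

Definition skew_unit_mx {R : realType} n (i j : 'I_n) : 'M[R]_n :=
  delta_mx i j - delta_mx j i.

Lemma tr_skew_unit_mx {R : realType} n (i j : 'I_n) :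
  (skew_unit_mx i j : 'M[R]_n)^T = - skew_unit_mx i j.
Proof. by rewrite /skew_unit_mx linearB /= !trmx_delta opprB. Qed.

Section DeltaDg.
Context {R : realType} {m n : nat} (hnm : (n <= m)%N).
Implicit Types (v : 'cV[R]_n).
Notation w := (widen_ord hnm).

Lemma inner_delta (i : 'I_m) (j : 'I_n) (M : 'M[R]_(m, n)) :
  inner (delta_mx i j) M = M i j.
Proof.
rewrite innerE (bigD1 i) //= [X in _ + X]big1 ?addr0 => [|k /negPf ki].
  rewrite (bigD1 j) //= big1 ?addr0 => [|k /negPf kj].
    by rewrite mxE !eqxx mul1r.
  by rewrite mxE kj andbF mul0r.
by rewrite big1 // => l _; rewrite mxE ki mul0r.
Qed.

Lemma delta_dg p (a : 'I_p) (j : 'I_n) v :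
  delta_mx a (w j) *m dg m v = v j 0 *: delta_mx a j.
Proof.
apply/matrixP => i k; rewrite !mxE (bigD1 (w j)) //= big1 ?addr0 => [|l /negPf lj].
  rewrite !mxE eqxx andbT; have [->|ne] := eqVneq k j; first by rewrite eqxx andbT mulrC.
  have -> : (j == k :> nat) = false.
    by apply/eqP => /val_inj jk; rewrite jk eqxx in ne.
  by rewrite mulr0n mulr0 andbF mulr0.
by rewrite !mxE lj andbF mul0r.
Qed.

Lemma delta_dg_out p (a : 'I_p) (q : 'I_m) v : (n <= q)%N ->
  delta_mx a q *m dg m v = 0.
Proof.
move=> nq; apply/matrixP => i k; rewrite !mxE big1 // => l _; rewrite !mxE.
have [->|] := eqVneq l q; last by rewrite andbF mul0r.
by rewrite [(q == k :> nat)]gtn_eqF ?mulr0n ?mulr0 // (leq_trans (ltn_ord k)).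
Qed.

Lemma dg_delta p (i : 'I_n) (b : 'I_p) v :
  dg m v *m delta_mx i b = v i 0 *: delta_mx (w i) b.
Proof.
apply/matrixP => a k; rewrite !mxE (bigD1 i) //= big1 ?addr0 => [|l /negPf lj].
  rewrite !mxE eqxx /= -(val_eqE a (w i)) /=.
  by case: (_ == _ :> nat); rewrite ?mul0r ?mulr0 // mulrC.
by rewrite !mxE lj mulr0.
Qed.

Lemma row_index_cases (q : 'I_m) : (exists i, q = w i) \/ (n <= q)%N.
Proof.
by have [qn|] := ltnP q n; [left; exists (Ordinal qn); apply: val_inj|right].
Qed.

Lemma dg_tr_entry v (M : 'M[R]_(m, n)) (i : 'I_n) (q : 'I_m) :
  (dg m v *m M^T) (w i) q = v i 0 * M q i.
Proof.
rewrite mxE (bigD1 i) //= big1 ?addr0 => [|l /negPf li]; first by rewrite !mxE eqxx.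
rewrite mxE; case: eqP => [/= e|_]; last by rewrite mul0r.
by rewrite -val_eqE /= e eqxx in li.
Qed.

Lemma dg_tr_entry_out v (M : 'M[R]_(m, n)) (p q : 'I_m) : (n <= p)%N ->
  (dg m v *m M^T) p q = 0.
Proof.
move=> np; rewrite mxE big1 // => l _.
by rewrite mxE gtn_eqF ?mulr0n ?mul0r // (leq_trans (ltn_ord l)).
Qed.

Lemma tr_dg_entry v (M : 'M[R]_(m, n)) (i j : 'I_n) :
  ((dg m v)^T *m M) i j = v i 0 * M (w i) j.
Proof.
rewrite mxE (bigD1 (w i)) //= big1 ?addr0 => [|l /negPf li]; first by rewrite !mxE eqxx.
rewrite !mxE; case: eqP => [e|_]; last by rewrite mul0r.
by rewrite -val_eqE /= e eqxx in li.
Qed.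

Lemma perm_dg (i j : 'I_n) v :
  tperm_mx (w i) (w j) *m dg m v *m (tperm_mx i j)^T =
  dg m (\col_k v (tperm i j k) 0).
Proof.
rewrite /tperm_mx tr_perm_mx -row_permE -col_permE; apply/matrixP => p q.
rewrite !mxE; congr (_ *+ _); congr nat_of_bool.
have wE : w (tperm i j q) = tperm (w i) (w j) (w q).
  by apply: inj_tperm => a b /(congr1 val) /= /val_inj.
have -> : (tperm (w i) (w j) p == tperm i j q :> nat) =
  (tperm (w i) (w j) p == tperm (w i) (w j) (w q)) by rewrite -wE -val_eqE.
by rewrite (inj_eq perm_inj) -val_eqE.
Qed.

End DeltaDg.

Lemma perm_mx_orth {R : realType} n (s : 'S_n) :
  orthogonal_mx (perm_mx s : 'M[R]_n).
Proof. by rewrite /orthogonal_mx tr_perm_mx -perm_mxM mulVg perm_mx1. Qed.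

(** Maximize the pairing of M with a diagonal matrix with distinct positive
    entries over the stabilizer of dg x.  At the maximum, rotations in the
    stabilizer show that the off-diagonal entries between equal x_i vanish, while
    the symmetry hypotheses make those between distinct x_i vanish;
    transpositions and sign changes give the order of the diagonal. *)
Lemma simultaneous_diag {R : realType} m n (hnm : (n <= m)%N) (x : 'cV[R]_n)
    (M : 'M[R]_(m, n)) :
  ordered_nonneg x ->
  (dg m x *m M^T)^T = dg m x *m M^T -> ((dg m x)^T *m M)^T = (dg m x)^T *m M ->
  exists P Q (k : 'cV[R]_n), [/\ stabilizer (dg m x) (P, Q),
    M = P *m dg m k *m Q^T,
    forall i j : 'I_n, (i <= j)%N -> x i 0 = x j 0 -> k j 0 <= k i 0 &
    forall i, x i 0 = 0 -> 0 <= k i 0].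
Proof.
move=> [x0 xi] sym1 sym2; pose w := widen_ord hnm.
(* weights n, n-1, ..., 1: any strictly decreasing positive vector would do *)
pose d : 'cV[R]_n := \col_j (n - j)%:R.
have d_gt0 j : 0 < d j 0 by rewrite mxE ltr0n subn_gt0.
have d_inj i j : d i 0 = d j 0 -> i = j.
  rewrite !mxE => /eqP; rewrite eqr_nat => /eqP h; apply: val_inj => /=.
  by have := ltn_ord i; have := ltn_ord j; lia.
have [P [Q [st hmax]]] := stabilizer_argmax (dg m x) (dg m d) M.
have [/= hP hQ hN] := st.
pose M' := P^T *m M *m Q.
have ME : M = P *m M' *m Q^T.
  by rewrite /M' !mulmxA orthE' // mul1mx -mulmxA orthE' // mulmx1.
have hmax' P' Q' : stabilizer (dg m x) (P', Q') ->
    inner (P' *m dg m d *m Q'^T) M' <= inner (dg m d) M'.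
  move=> st'; have := hmax _ _ (stabilizer_mul st st').
  rewrite trmx_mul !mulmxA -2!(mulmxA P) ME inner_orth //.
  by rewrite inner_orth // !mulmxA.
have NE : dg m x = P^T *m dg m x *m Q.
  by rewrite -{2}hN !mulmxA orthE // mul1mx -mulmxA orthE // mulmx1.
have sym1' : (dg m x *m M'^T)^T = dg m x *m M'^T.
  have -> : dg m x *m M'^T = P^T *m (dg m x *m M^T) *m P.
    rewrite {1}NE /M' !trmx_mul trmxK !mulmxA; congr (_ *m _ *m _).
    by rewrite -mulmxA orthE' // mulmx1.
  by rewrite trmx_mul (trmx_mul (P^T)) sym1 trmxK !mulmxA.
have sym2' : ((dg m x)^T *m M')^T = (dg m x)^T *m M'.
  have -> : (dg m x)^T *m M' = Q^T *m ((dg m x)^T *m M) *m Q.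
    rewrite {1}NE /M' !trmx_mul trmxK !mulmxA; congr (_ *m _).
    by rewrite -(mulmxA _ P P^T) orthE' // mulmx1.
  by rewrite trmx_mul (trmx_mul (Q^T)) sym2 trmxK !mulmxA.
clearbody M'.
have S1 i j : x i 0 * M' (w j) i = x j 0 * M' (w i) j.
  have /matrixP /(_ (w j) (w i)) := sym1'.
  by rewrite mxE !dg_tr_entry.
have S2 i (q : 'I_m) : (n <= q)%N -> x i 0 * M' q i = 0.
  move=> nq; have /matrixP /(_ q (w i)) := sym1'.
  by rewrite mxE dg_tr_entry dg_tr_entry_out.
have S3 i j : x i 0 * M' (w i) j = x j 0 * M' (w j) i.
  have /matrixP /(_ j i) := sym2'.
  by rewrite mxE !(tr_dg_entry hnm).
(* rotation by the same angle in the rows and in the columns i, j *)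
have I i j : x i 0 = x j 0 ->
    (d j 0 - d i 0) * (M' (w i) j + M' (w j) i) = 0.
  move=> xij.
  have := @stabilizer_first_order _ _ _ (dg m x) (dg m d) M'
    (skew_unit_mx (w i) (w j)) (skew_unit_mx i j) hmax'
    (tr_skew_unit_mx _ _) (tr_skew_unit_mx _ _).
  rewrite /skew_unit_mx !mulmxBl !mulmxBr !delta_dg !(dg_delta hnm) xij.
  move=> /(_ erefl); rewrite !inner_lin !inner_delta => h; rewrite -h; ring.
(* if x_i = x_j = 0 the rows can be rotated alone *)
have II i j : x i 0 = 0 -> x j 0 = 0 -> d j 0 * M' (w i) j = d i 0 * M' (w j) i.
  move=> xi0 xj0.
  have := @stabilizer_first_order _ _ _ (dg m x) (dg m d) M'
    (skew_unit_mx (w i) (w j)) 0 hmax' (tr_skew_unit_mx _ _).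
  rewrite /skew_unit_mx !mulmxBl !delta_dg xi0 xj0 !scale0r !mulmx0 subr0.
  move=> /(_ _ erefl); rewrite subr0 !inner_lin !inner_delta trmx0 oppr0.
  by move=> /(_ erefl) h; lra.
(* rotation of a row q beyond the columns with a row j such that x_j = 0 *)
have III (q : 'I_m) j : (n <= q)%N -> x j 0 = 0 -> M' q j = 0.
  move=> nq xj0.
  have := @stabilizer_first_order _ _ _ (dg m x) (dg m d) M'
    (skew_unit_mx q (w j)) 0 hmax' (tr_skew_unit_mx _ _).
  rewrite /skew_unit_mx !mulmxBl !delta_dg !delta_dg_out // xj0 scale0r !mulmx0 subr0.
  move=> /(_ _ erefl); rewrite !subr0 !inner_lin !inner_delta trmx0 oppr0.
  by move=> /(_ erefl) /eqP; rewrite mulf_eq0 gt_eqF //= => /eqP.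
pose k : 'cV[R]_n := \col_i M' (w i) i.
have M'E : M' = dg m k.
  apply/matrixP => q j; rewrite mxE.
  have [[i ->]|nq] := row_index_cases hnm q; last first.
    rewrite gtn_eqF ?(leq_trans (ltn_ord j)) // mulr0n.
    by have [xj0|xj0] := eqVneq (x j 0) 0; [exact: III|
      have /eqP := S2 j q nq; rewrite mulf_eq0 (negPf xj0) => /eqP].
  have [->|ij] := eqVneq i j; first by rewrite eqxx mxE.
  rewrite [(_ == _ :> nat)](negPf ij) mulr0n -/(w i).
  have dij : d j 0 - d i 0 != 0.
    by rewrite subr_eq0; apply: contra ij => /eqP /d_inj ->.
  have [xij|xij] := eqVneq (x i 0) (x j 0).
    have /eqP := I i j xij; rewrite mulf_eq0 (negPf dij) /= => /eqP ab0.
    have [xi0|xi0] := eqVneq (x i 0) 0.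
      have := II i j xi0 (etrans (esym xij) xi0).
      have -> : M' (w j) i = - M' (w i) j by lra.
      move=> h; have /eqP : (d j 0 + d i 0) * M' (w i) j = 0 by lra.
      by rewrite mulf_eq0 gt_eqF ?addr_gt0 //= => /eqP.
    have := S1 i j; rewrite -xij => /(mulfI xi0) h; lra.
  have /eqP : (x i 0 - x j 0) * ((x i 0 + x j 0) * M' (w i) j) = 0.
    have e1 := S1 i j; have e3 := S3 i j.
    have : x i 0 * (x i 0 * M' (w i) j) = x j 0 * (x j 0 * M' (w i) j).
      by rewrite e3 -e1; ring.
    by move=> h; rewrite mulrA -subr_sqr; lra.
  rewrite mulf_eq0 subr_eq0 (negPf xij) /= mulf_eq0 => /orP[|/eqP //].
  rewrite paddr_eq0 ?x0 // => /andP[/eqP a /eqP b].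
  by rewrite a b eqxx in xij.
exists P, Q, k; split => //; first by rewrite -M'E.
  move=> i j; rewrite leq_eqVlt => /orP[/eqP/val_inj->//|ij] xij.
  have st' : stabilizer (dg m x) (tperm_mx (w i) (w j), tperm_mx i j).
    split => /=; try exact: perm_mx_orth.
    rewrite perm_dg; congr dg; apply/colP => l; rewrite mxE.
    by case: tpermP => [->|->|].
  have := hmax' _ _ st'; rewrite perm_dg M'E !inner_dg // !inner_cV.
  have ji : j != i by rewrite -val_eqE /= gtn_eqF.
  rewrite [leLHS](bigD1 i) //= [leRHS](bigD1 i) //=.
  rewrite [X in _ + X <= _](bigD1 j) //= [X in _ <= _ + X](bigD1 j) //=.
  rewrite (eq_bigr (fun l => d l 0 * k l 0)) => [|l /andP[li lj]]; last first.
    by rewrite mxE tpermD // eq_sym.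
  rewrite !addrA lerD2r ![(\col__ _) _ _]mxE tpermL tpermR => h.
  have dij : 0 < d i 0 - d j 0.
    by rewrite subr_gt0 !mxE ltr_nat; have := ltn_ord j; lia.
  by rewrite -subr_ge0 -(pmulr_rge0 _ dij); move: h; rewrite !mxE; nra.
move=> i xi0.
pose C : 'M[R]_m := 1%:M - 2 *: delta_mx (w i) (w i).
have CD v : C *m dg m v *m 1%:M^T = dg m v - (2 * v i 0) *: delta_mx (w i) i.
  by rewrite trmx1 mulmx1 mulmxBl mul1mx -scalemxAl delta_dg scalerA.
have st' : stabilizer (dg m x) (C, 1%:M).
  split => /=; [|exact: orth1|by rewrite CD xi0 mulr0 scale0r subr0].
  have CT : C^T = C by rewrite /C linearB /= trmx1 linearZ /= trmx_delta.
  rewrite /orthogonal_mx CT /C mulmxBl mul1mx mulmxBr mulmx1 -scalemxAl -scalemxAr mul_delta_mx.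
  by apply/matrixP => a b; rewrite !mxE; ring.
have := hmax' _ _ st'; rewrite CD !inner_lin inner_delta => h.
by rewrite -(pmulr_rge0 _ (d_gt0 i)) [k i 0]mxE; lra.
Qed.

(** The case x = 0 is the existence of a singular value decomposition. *)
Lemma svd_exists {R : realType} m n (hnm : (n <= m)%N) (X : 'M[R]_(m, n)) :
  exists U V, svd_pairs X (U, V).
Proof.
have dg0 : dg m (0 : 'cV[R]_n) = 0.
  by apply/matrixP => i j; rewrite !mxE mul0rn.
have [| |P [Q [k [[/= hP hQ _] XE ki k0]]]] :=
  @simultaneous_diag R m n hnm 0 X (ordered_nonneg0).
- by rewrite dg0 mul0mx trmx0.
- by rewrite dg0 trmx0 mul0mx trmx0.
have hk : ordered_nonneg k.
  by split => [i|i j ij]; [apply: k0|apply: ki]; rewrite ?mxE.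
exists P, Q; split => //=; rewrite Sigma_dg {2}XE sing_vals_orth //.
by rewrite sing_vals_dg.
Qed.

(** * Von Neumann's inequality and families attaining it *)

Section VonNeumann.
Context {R : realType} {m n : nat} (hnm : (n <= m)%N).
Implicit Types A B X Y : 'M[R]_(m, n).

Lemma von_neumann A B : inner A B <= inner (svals A) (svals B).
Proof.
have [U [V [/= hU hV AE]]] := svd_exists hnm A.
have [U' [V' [/= hU' hV' BE]]] := svd_exists hnm B.
rewrite {1}AE {1}BE !Sigma_dg inner_mulr trmxK inner_mull.
have -> : U^T *m (U' *m dg m (svals B) *m V'^T *m V) =
    (U^T *m U') *m dg m (svals B) *m (V^T *m V')^T.
  by rewrite trmx_mul trmxK !mulmxA.
by apply: von_neumann_diag => //; try exact: sing_vals_ordered;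
  apply: orth_mul => //; exact: orth_tr.
Qed.

Lemma inner_sing_vals A : inner (svals A) (svals A) = inner A A.
Proof.
have [U [V [/= hU hV AE]]] := svd_exists hnm A.
by rewrite [in RHS]AE inner_orth // Sigma_dg inner_dg.
Qed.

(** Expand both squares: the norms agree and the cross terms are compared by the
    trace inequality. *)
Lemma sing_vals_nonexpansive A B :
  inner (svals A - svals B) (svals A - svals B)
    <= inner (A - B) (A - B).
Proof.
have := von_neumann A B; rewrite !inner_lin.
rewrite (inner_sing_vals A) (inner_sing_vals B).
rewrite (innerC B A) (innerC (svals B) (svals A)). lra.
Qed.

(** Equality in von Neumann's inequality propagates from pairs to families: if
    all pairs of the family attain it, then the singular values of the sum W
    are the sums w of the singular values, by Cauchy-Schwarz.  For a singular
    value decomposition (U, V) of W, the vectors w - x_i are again ordered, and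
    the trace inequality for U dg(w - x_i) V^T gives <X_i, U dg(x_i) V^T> >=
    |x_i|^2, which forces the two matrices to coincide. *)
Lemma common_svd (I : finType) (X : I -> 'M[R]_(m, n)) :
  (forall i j, inner (X i) (X j) = inner (svals (X i)) (svals (X j))) ->
  exists U V, forall i, svd_pairs (X i) (U, V).
Proof.
move=> hX; pose W := \sum_i X i; pose w := svals W.
pose s := \sum_i svals (X i).
have [U [V [/= hU hV WE]]] := svd_exists hnm W.
have ss : inner s s = inner w w.
  rewrite inner_sing_vals /s /W !inner_suml; apply: eq_bigr => i _.
  by rewrite !inner_sumr; apply: eq_bigr => j _.
have le_i i : inner (X i) W <= inner (svals (X i)) w by exact: von_neumann.
have WW : inner w w = \sum_i inner (X i) W.
  by rewrite inner_sing_vals {1}/W inner_suml.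
have sw : inner s w = \sum_i inner (svals (X i)) w by rewrite inner_suml.
have wE : w = s.
  apply/eqP; rewrite -subr_eq0; apply/eqP; apply: inner_le0_eq0.
  rewrite !inner_lin (innerC w s) ss.
  have : inner w w <= inner s w by rewrite WW sw; apply: ler_sum.
  lra.
have eq_i i : inner (X i) W = inner (svals (X i)) w.
  apply/eqP; rewrite eq_le le_i /= -subr_le0.
  have : \sum_j (inner (svals (X j)) w - inner (X j) W) = 0.
    by rewrite sumrB -sw -WW -wE subrr.
  move=> /eqP; rewrite psumr_eq0 => [/allP /(_ i (mem_index_enum i))/= /eqP ->|j _] //.
  by rewrite subr_ge0.
have diff i : ordered_nonneg (w - svals (X i)).
  rewrite wE /s (bigD1 i) //= addrAC subrr add0r.
  by elim/big_ind: _ => [|a b|j _];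
    [exact: ordered_nonneg0|exact: ordered_nonnegD|exact: sing_vals_ordered].
exists U, V => i; split; [exact: hU|exact: hV|rewrite /= Sigma_dg]; set x := svals (X i).
pose N := U *m dg m x *m V^T.
have NN : inner N N = inner x x by rewrite /N inner_orth // inner_dg.
have XN : inner x x <= inner (X i) N.
  have sD : svals (W - N) = w - x.
    have -> : W - N = U *m dg m (w - x) *m V^T.
      by rewrite dgB mulmxBr mulmxBl -[dg m w]Sigma_dg -WE.
    by rewrite sing_vals_orth // sing_vals_dg //; exact: diff.
  have := von_neumann (X i) (W - N).
  by rewrite sD !inner_lin eq_i -/x; lra.
apply/eqP; rewrite -subr_eq0; apply/eqP; apply: inner_le0_eq0.
rewrite -/N !inner_lin (innerC N) NN -(inner_sing_vals (X i)) -/x; lra.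
Qed.

End VonNeumann.

(** * The directional derivative of the singular values *)

Section DirectionalDerivative.
Context {R : realType} {m n : nat} (hnm : (n <= m)%N).
Implicit Types X H : 'M[R]_(m, n).

(** An affine function that does not become negative to first order at 0 stays
    nonnegative on the right of 0; each ordering constraint below has this form. *)
Lemma near_affine_ge0 (c e : R) : 0 <= c -> (c = 0 -> 0 <= e) ->
  \forall s \near 0^'+, 0 <= c + s * e.
Proof.
rewrite le_eqVlt => /orP[/eqP <-|c0] h.
  near=> s; rewrite add0r; apply: mulr_ge0; last exact: h.
  by apply: ltW; near: s; exact: nbhs_right_gt.
near=> s.
have s0 : 0 < s by near: s; exact: nbhs_right_gt.
have : s < c / (`|e| + 1).
  by near: s; apply: nbhs_right_lt; rewrite divr_gt0 // ltr_wpDl.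
rewrite ltr_pdivlMr ?ltr_wpDl // => se.
have := ler_norm (- e); rewrite normrN => h1.
have : s * - e <= s * `|e| by rewrite ler_wpM2l // ltW.
nra.
Unshelve. all: by end_near. Qed.

(** This is simultaneous_diag read in a singular frame of X; the order of k on
    the ties and on the zeros of sigma(X) keeps sigma(X) + sk ordered. *)
Lemma common_diag X H : (X *m H^T)^T = X *m H^T -> (X^T *m H)^T = X^T *m H ->
  exists U V k, [/\ svd_pairs X (U, V), H = U *m dg m k *m V^T &
    \forall s \near 0^'+, ordered_nonneg (svals X + s *: k)].
Proof.
move=> sym1 sym2; have [U [V [/= hU hV XE]]] := svd_exists hnm X.
rewrite Sigma_dg in XE; set x := svals X in XE *.
pose M := U^T *m H *m V.
have HE : H = U *m M *m V^T.
  by rewrite /M !mulmxA orthE' // mul1mx -mulmxA orthE' // mulmx1.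
have DE : dg m x = U^T *m X *m V.
  by rewrite XE !mulmxA orthE // mul1mx -mulmxA orthE // mulmx1.
have sym1' : (dg m x *m M^T)^T = dg m x *m M^T.
  have -> : dg m x *m M^T = U^T *m (X *m H^T) *m U.
    rewrite DE /M !trmx_mul trmxK !mulmxA; congr (_ *m _ *m _).
    by rewrite -mulmxA orthE' // mulmx1.
  by rewrite trmx_mul (trmx_mul (U^T)) sym1 trmxK !mulmxA.
have sym2' : ((dg m x)^T *m M)^T = (dg m x)^T *m M.
  have -> : (dg m x)^T *m M = V^T *m (X^T *m H) *m V.
    rewrite DE /M !trmx_mul trmxK !mulmxA; congr (_ *m _).
    by rewrite -(mulmxA _ U (U^T)) orthE' // mulmx1.
  by rewrite trmx_mul (trmx_mul (V^T)) sym2 trmxK !mulmxA.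
have [P [Q [k [[/= hP hQ PQ] ME ki k0]]]] :=
  simultaneous_diag hnm (sing_vals_ordered X) sym1' sym2'.
exists (U *m P), (V *m Q), k; split.
- split => /=; try exact: orth_mul.
  rewrite trmx_mul !mulmxA -2!(mulmxA U) Sigma_dg -/x PQ; exact: XE.
- by rewrite {1}HE {1}ME trmx_mul !mulmxA.
- have [x0 xi] := sing_vals_ordered X.
  have n1 : \forall s \near 0^'+, forall i, 0 <= x i 0 + s * k i 0.
    by apply: filter_forall => i; apply: near_affine_ge0 => // /k0.
  have n2 : \forall s \near 0^'+, forall i j : 'I_n, (i <= j)%N ->
      0 <= (x i 0 - x j 0) + s * (k i 0 - k j 0).
    apply: filter_forall => i; apply: filter_forall => j.
    have [ij|_] := boolP (i <= j)%N; last by near=> s.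
    have : \forall s \near 0^'+, 0 <= (x i 0 - x j 0) + s * (k i 0 - k j 0).
      apply: near_affine_ge0; first by rewrite subr_ge0 xi.
      by move=> /eqP; rewrite !subr_ge0 subr_eq0 => /eqP; apply: ki.
    by apply: filterS.
  near=> s; split=> [i|i j ij]; rewrite !mxE.
    by move: i; near: s.
  have : 0 <= (x i 0 - x j 0) + s * (k i 0 - k j 0).
    by move: i j ij; near: s.
  rewrite /x; lra.
Unshelve. all: by end_near. Qed.

Lemma expands2_affine {T : Type} (F : set_system T) (FF : Filter F)
    (tau : T -> R) X H : expands2 F tau (fun t => X + tau t *: H) X H 0.
Proof. by exists (fun=> 0) => [|t]; [exact: cvg_cst|rewrite scaler0 addr0]. Qed.

End DirectionalDerivative.

(** Convergence to 0 by domination in Frobenius norm; u and v may have different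
    shapes, such as a vector of singular values and a matrix. *)
Lemma cvg_inner_self0 {R : realType} {T : Type} (F : set_system T)
    (FF : Filter F) p q p' q' (u : T -> 'M[R]_(p, q)) (v : T -> 'M[R]_(p', q')) :
  v @ F --> (0 : 'M[R]_(p', q')) ->
  (\forall t \near F, inner (u t) (u t) <= inner (v t) (v t)) ->
  u @ F --> (0 : 'M[R]_(p, q)).
Proof.
move=> v0 uv; apply/cvg_entryP => i j; rewrite mxE.
have s0 : Num.sqrt (inner (v t) (v t)) @[t --> F] --> (0 : R).
  have <- : Num.sqrt (inner (0 : 'M[R]_(p', q')) 0) = 0 :> R.
    by rewrite -(scale0r (0 : 'M[R]_(p', q'))) innerZl mul0r sqrtr0.
  have c := cvg_inner v0 v0; have sc := @sqrt_continuous R (inner (0 : 'M[R]_(p', q')) 0).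
  exact (@cvg_comp _ _ _ (fun t => inner (v t) (v t)) Num.sqrt _ _ _ (c FF) sc).
apply/norm_cvg0P; apply: (squeeze_cvgr _ (cvg_cst 0) s0).
apply: filterS uv => t uvt; rewrite normr_ge0 /= -sqrtr_sqr ler_wsqrtr //.
apply: le_trans uvt; rewrite innerE (bigD1 i) //= (bigD1 j) //= -expr2 -addrA.
by rewrite lerDl addr_ge0 //; repeat (apply: sumr_ge0 => ? _);
  rewrite -expr2 sqr_ge0.
Qed.

(** H is the sum of a vector AX - XB tangent to the orbit of X under the
    orthogonal groups and of H0, which is normal to it. *)
Definition orbit_split {R : realType} m n (X H : 'M[R]_(m, n)) A B H0 : Prop :=
  [/\ A^T = - A, B^T = - B, H = A *m X - X *m B + H0,
      (X *m H0^T)^T = X *m H0^T & (X^T *m H0)^T = X^T *m H0].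

Section UniformDirectionalDerivative.
Context {R : realType} {m n : nat} (hnm : (n <= m)%N).
Implicit Types X H : 'M[R]_(m, n).

(** The joint limit t to 0 from the right, W to H, along which all the
    subderivatives are lower limits. *)
Definition dir_filter H : set_system (R * 'M[R]_(m, n))%type :=
  filter_prod (0 : R)^'+ (nbhs H).

#[local] Instance dir_filter_filter H : ProperFilter (dir_filter H).
Proof. by apply: filter_prod_proper. Qed.

Lemma dir_filter_fst H : (fun tW => tW.1) @ dir_filter H --> (0 : R)^'+.
Proof. exact: cvg_fst. Qed.

Lemma dir_filter_snd H : (fun tW => tW.2) @ dir_filter H --> H.
Proof. exact: cvg_snd. Qed.

Lemma dir_filter_tau H : (fun tW => tW.1) @ dir_filter H --> (0 : R).
Proof. by apply: cvg_trans (@dir_filter_fst H) _; apply: cvg_within. Qed.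

Lemma svdE X U V : svd_pairs X (U, V) ->
  [/\ orthogonal_mx U, orthogonal_mx V & X = U *m dg m (svals X) *m V^T].
Proof. by rewrite -Sigma_dg. Qed.

Lemma cayley_half_orth p (t : R) (C : 'M[R]_p) :
  C^T = - C -> orthogonal_mx (cayley ((2^-1 * t) *: C)).
Proof.
by move=> hC; apply: cayley_orth; rewrite linearZ /= hC scalerN.
Qed.

(** The tangent part of H changes X only by an orthogonal motion, up to second
    order, and the singular values along H0 are exactly affine. *)
Lemma svals_directional X H A B H0 U V k :
  orbit_split X H A B H0 -> svd_pairs X (U, V) -> H0 = U *m dg m k *m V^T ->
  (\forall s \near 0^'+, ordered_nonneg (svals X + s *: k)) ->
  tW.1^-1 *: (svals (X + tW.1 *: tW.2) - svals X) @[tW --> dir_filter H] --> k.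
Proof.
case=> hA hB HE _ _ /svdE [hU hV XE] H0E ord.
have tau0 := @dir_filter_tau H.
have [r rc rE] := expands2_orbit _ tau0 hA hB
  (expands2_affine (dir_filter_filter H) (fun tW => tW.1) X H0).
rewrite -HE in rE.
apply/subr_cvg0; pose v (tW : R * 'M[R]_(m, n)) := tW.2 - H - tW.1 *: r tW.
apply: (@cvg_inner_self0 _ _ _ _ _ _ _ _ _ v).
  set r0 := (X in r @ _ --> X) in rc.
  have -> : 0 = H - H - 0 *: r0 by rewrite subrr scale0r subr0.
  apply: cvgB; last exact: cvgZ.
  by apply: cvgB; [exact: dir_filter_snd|exact: cvg_cst].
have ord' : \forall tW \near dir_filter H,
    0 < tW.1 /\ ordered_nonneg (svals X + tW.1 *: k).
  have P0 : \forall t \near 0^'+, 0 < t /\ ordered_nonneg (svals X + t *: k).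
    by apply: filterI ord; exact: nbhs_right_gt.
  exact: (@dir_filter_fst H _ P0).
apply: filterS ord' => -[t W] /= [t0 ordt].
(* by nonexpansiveness X + tW may be compared with a point C on the orbit arc *)
pose C := cayley ((2^-1 * t) *: A) *m (X + t *: H0)
          *m (cayley ((2^-1 * t) *: B))^T.
have sC : svals C = svals X + t *: k.
  rewrite sing_vals_orth; try exact: cayley_half_orth.
  rewrite {1}XE H0E scalemxAl scalemxAr -mulmxDl -mulmxDr -dgZ -dgD.
  by rewrite sing_vals_orth // sing_vals_dg.
have CE : C = X + t *: H + t ^+ 2 *: r (t, W) by rewrite -(rE (t, W)).
have -> : t^-1 *: (svals (X + t *: W) - svals X) - k =
    t^-1 *: (svals (X + t *: W) - svals C).
  by rewrite sC opprD addrA [RHS]scalerBr scalerA mulVf ?gt_eqF // scale1r.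
have -> : v (t, W) = t^-1 *: (X + t *: W - C).
  rewrite CE /v /=; apply/matrixP => i j; rewrite !mxE.
  by field; rewrite gt_eqF.
rewrite !innerZl !innerZr; do 2 (rewrite ler_pM2l ?invr_gt0 //).
exact: sing_vals_nonexpansive.
Qed.

Lemma dderiv_eq X H k :
  tW.1^-1 *: (svals (X + tW.1 *: tW.2) - svals X) @[tW --> dir_filter H] --> k ->
  sing_vals_dderiv X H = k.
Proof.
move=> hk; rewrite /sing_vals_dderiv; apply: cvg_lim; first exact: norm_hausdorff.
have c : (fun t : R => (t, H)) @ 0^'+ --> dir_filter H.
  move=> S [[P Q] [/= hP hQ] PQS]; apply: filterS hP => t Pt.
  by apply: PQS; split => //=; exact: nbhs_singleton hQ.
have := cvg_comp _ _ c hk; rewrite svals.unlock; exact.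
Qed.

End UniformDirectionalDerivative.

(** * Lower limits of extended-real functions along filters *)

Section LowerLimits.
Context {R : realType}.
Local Open Scope ereal_scope.

(** Every passage between difference quotients of f and of f o sigma has this
    form, with theta the induced change of direction and u a correction term. *)
Lemma limf_einf_comparison (T T' : choiceType) (X : filteredType T)
    (X' : filteredType T') (F : set_system X)
    (F' : set_system X') (FF' : ProperFilter F') (phi : X -> \bar R)
    (psi : X' -> \bar R) (theta : X' -> X) (u : X' -> R) (l : R) :
  theta @ F' --> F -> u @ F' --> l ->
  (\forall t \near F', phi (theta t) + (u t)%:E <= psi t) ->
  limf_einf phi F + l%:E <= limf_einf psi F'.
Proof.
move=> thF ul le_pp; apply/lee_addgt0Pr => e e0.
rewrite -leeBrDr // [X in X <= _]limf_einfE; apply: ge_ereal_sup => _ [V FV <-].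
rewrite leeBrDr // -leeBlDr // limf_einfE.
pose V' := [set t | V (theta t) /\
  (phi (theta t) + (u t)%:E <= psi t /\ (l - e < u t)%R)].
have FV' : F' V'.
  apply: filterI; first exact: thF.
  by apply: filterI => //; apply: cvgr_gt ul _ _; rewrite ltrBlDr ltrDl.
apply: le_trans (ereal_sup_ubound _); last by exists V'.
apply: le_ereal_inf_tmp => _ [t [Vt [pt ut]] <-].
apply: le_trans pt; rewrite -addeA -EFinB; apply: leeD.
  by apply: ereal_inf_lbound; exists (theta t).
by rewrite lee_fin ltW.
Qed.

Lemma limf_einf_ge (T : choiceType) (X : filteredType T) (F : set_system X)
    (FF : ProperFilter F) (psi : X -> \bar R) (u : X -> R) (l : R) :
  u @ F --> l -> (\forall t \near F, (u t)%:E <= psi t) ->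
  l%:E <= limf_einf psi F.
Proof.
move=> ul up.
have h : limf_einf (fun=> 0) F + l%:E <= limf_einf psi F.
  apply: (@limf_einf_comparison _ _ _ _ F F FF _ _ id _ _ _ ul) => //.
  by apply: filterS up => t; rewrite add0e.
apply: le_trans h; rewrite -[leLHS]add0e; apply: leeD => //.
rewrite limf_einfE; apply: le_trans (ereal_sup_ubound _); last first.
  by exists setT => //; exact: filterT.
by apply: le_ereal_inf_tmp => _ [t _ <-].
Qed.

Lemma limf_einf_le_map (T T' : choiceType) (X : filteredType T)
    (X' : filteredType T') (F : set_system X)
    (F' : set_system X') (FF' : ProperFilter F') (phi : X -> \bar R)
    (psi : X' -> \bar R) (theta : X' -> X) :
  theta @ F' --> F -> (\forall t \near F', phi (theta t) <= psi t) ->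
  limf_einf phi F <= limf_einf psi F'.
Proof.
move=> thF h; rewrite -[leLHS]adde0.
apply: (limf_einf_comparison FF' thF (cvg_cst 0%R)).
by apply: filterS h => t; rewrite adde0.
Qed.

End LowerLimits.

(** * First-order analysis of f o sigma *)

Section FirstOrder.
Context {R : realType} {m n : nat} (hnm : (n <= m)%N).
Variables (f : 'cV[R]_n -> \bar R).
Hypothesis f_sym : absolutely_symmetric f.
Variables (X Y : 'M[R]_(m, n)).
Hypothesis XY_subdiff : subdifferential (f \o sing_vals) X Y.

Notation g := (f \o sing_vals).
Notation x := (svals X).
Notation y := (svals Y).

Lemma compE (Z : 'M[R]_(m, n)) : g Z = f (svals Z).
Proof. by rewrite svals.unlock. Qed.

Lemma f_orbit (U : 'M[R]_m) (V : 'M[R]_n) v :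
  orthogonal_mx U -> orthogonal_mx V -> f (svals (U *m dg m v *m V^T)) = f v.
Proof. by move=> hU hV; rewrite sing_vals_orth // abs_sym_dg. Qed.

Lemma fx_fin : f x \is a fin_num.
Proof. by case: XY_subdiff; rewrite compE. Qed.

(** Rotating X onto the singular frame of Y leaves g unchanged and would
    increase the pairing with Y beyond what the subgradient inequality allows. *)
Lemma subgradient_aligned : inner X Y = inner x y.
Proof.
apply/eqP; rewrite eq_le von_neumann //=.
have [U [V /svdE [hU hV YE]]] := svd_exists hnm Y.
have [_ /(_ (U *m dg m x *m V^T))] := XY_subdiff.
rewrite !compE f_orbit // -{2}[f x]adde0 leeD2lE ?fx_fin // lee_fin.
by rewrite innerDr innerNr {1}YE inner_orth // inner_dg // innerC (innerC Y); lra.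
Qed.

(** The two matrices attain equality in the trace inequality. *)
Lemma subgradient_common_svd : exists U V, svd_pairs X (U, V) /\ svd_pairs Y (U, V).
Proof.
have [|U [V h]] := @common_svd R m n hnm bool (fun b => if b then X else Y).
  by move=> [] []; rewrite ?inner_sing_vals // ?subgradient_aligned //
    innerC subgradient_aligned innerC.
by exists U, V; split; [exact: (h true)|exact: (h false)].
Qed.

(** Test the subgradient inequality on matrices that are diagonal in the common
    frame. *)
Lemma subgradient_svals v : (f x + (inner y (v - x))%:E <= f v)%E.
Proof.
have [U [V [/svdE [hU hV XE] /svdE [_ _ YE]]]] := subgradient_common_svd.
have [_ /(_ (U *m dg m v *m V^T))] := XY_subdiff.
rewrite !compE f_orbit // {2}XE -mulmxBl -mulmxBr -dgB {1}YE.
by rewrite inner_orth // inner_dg.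
Qed.

Lemma f_neq_ninfty v : f v != -oo%E.
Proof.
have := subgradient_svals v; have := fx_fin.
by case: (f x) => // r _; case: (f v).
Qed.

Variables (H : 'M[R]_(m, n)) (h : 'cV[R]_n).
Hypothesis svals_h :
  tW.1^-1 *: (svals (X + tW.1 *: tW.2) - x) @[tW --> dir_filter H] --> h.

#[local] Existing Instance dir_filter_filter.

(** The direction in which the singular values actually move from X to X + tW;
    it carries quotients of f at x to quotients of f o sigma at X. *)
Let theta (tW : R * 'M[R]_(m, n)) : R * 'cV[R]_n :=
  (tW.1, tW.1^-1 *: (svals (X + tW.1 *: tW.2) - x)).

Lemma theta_cvg : theta @ dir_filter H --> dir_filter h.
Proof.
move=> S [[P Q] [/= hP hQ] PQS].
have h1 : dir_filter H [set tW | P (theta tW).1] := @dir_filter_fst _ _ _ H _ hP.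
have h2 : dir_filter H [set tW | Q (theta tW).2] := svals_h hQ.
suff : dir_filter H (theta @^-1` S) by [].
apply: (@filterS _ (dir_filter H) _ _ _ _ (filterI h1 h2)) => tW [Pt Qt].
exact: (PQS (theta tW) (conj Pt Qt)).
Qed.

Lemma dir_pos p q (W : 'M[R]_(p, q)) : \forall tW \near dir_filter W, 0 < tW.1.
Proof. by have := @dir_filter_fst _ _ _ W _ (nbhs_right_gt 0). Qed.

Lemma theta_svals (t : R) W : 0 < t -> x + t *: (theta (t, W)).2 = svals (X + t *: W).
Proof.
by move=> t0; rewrite /theta /= scalerA divff ?gt_eqF // scale1r addrC subrK.
Qed.

(** Divide the trace inequality for Y and X + tW, an equality at t = 0, by t. *)
Lemma inner_le_dderiv : inner Y H <= inner y h.
Proof.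
have c1 : inner y (theta tW).2 @[tW --> dir_filter H] --> inner y h.
  by apply: cvg_inner; [exact: cvg_cst|exact: svals_h].
have c0 : inner Y tW.2 @[tW --> dir_filter H] --> inner Y H.
  by apply: cvg_inner; [exact: cvg_cst|exact: dir_filter_snd].
apply: (ler_cvg_to c0 c1).
apply: filterS (dir_pos H) => -[t W] /= t0.
rewrite -(ler_pM2l t0) -!innerZr; have := theta_svals W t0; rewrite /theta /= => e.
have vn := von_neumann hnm Y (X + t *: W); rewrite -e in vn.
move: vn; rewrite innerDr [leRHS]innerDr (innerC Y X) subgradient_aligned.
by rewrite (innerC x y) lerD2l.
Qed.

Lemma dderiv_le_subderivative : ((inner y h)%:E <= subderivative f x h)%E.
Proof.
rewrite /subderivative /liminf_right.
have c1 : inner y tw.2 @[tw --> dir_filter h] --> inner y h.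
  by apply: cvg_inner; [exact: cvg_cst|exact: dir_filter_snd].
apply: (limf_einf_ge _ c1); apply: filterS (dir_pos h) => -[t w] /= t0.
have := subgradient_svals (x + t *: w); have := f_neq_ninfty (x + t *: w).
have -> : x + t *: w - x = t *: w by rewrite addrAC subrr add0r.
rewrite innerZr.
have := fx_fin; case: (f x) => // a _; case: (f _) => // [b _|_ _].
  rewrite -!EFinD -EFinM !lee_fin => hb; rewrite ler_pdivlMr //; lra.
by rewrite /= gt0_mulye ?leey // lte_fin invr_gt0.
Qed.

Lemma subderivative_comp_ge : (subderivative f x h <= subderivative g X H)%E.
Proof.
rewrite /subderivative /liminf_right.
apply: (limf_einf_le_map _ theta_cvg).
apply: filterS (dir_pos H) => -[t W] /= t0.
have := theta_svals W t0; rewrite /theta /= => ->.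
by rewrite svals.unlock.
Qed.

Hypothesis H_crit : critical_cone g X Y H.

(** In the chain <Y,H> <= <y,h> <= df(x)(h) <= dg(X)(H) criticality forces
    equality throughout. *)
Lemma critical_inner : inner Y H = inner y h.
Proof.
apply/eqP; rewrite eq_le inner_le_dderiv /= -lee_fin -H_crit.
exact: le_trans dderiv_le_subderivative subderivative_comp_ge.
Qed.

Lemma critical_subderivative : subderivative f x h = (inner y h)%:E.
Proof.
apply/eqP; rewrite eq_le dderiv_le_subderivative andbT -critical_inner -H_crit.
exact: subderivative_comp_ge.
Qed.

End FirstOrder.

(** * Second-order analysis of f o sigma *)

Section DiagonalProducts.
Context {R : realType} {m n : nat}.

Lemma dg_mul_tr (v w : 'cV[R]_n) :
  dg m v *m (dg m w)^T = dg m w *m (dg m v)^T.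
Proof.
apply/matrixP => i j; rewrite !mxE; apply: eq_bigr => l _; rewrite !mxE.
by rewrite !mulrnAl !mulrnAr mulrC.
Qed.

Lemma dg_tr_mul (v w : 'cV[R]_n) :
  (dg m v)^T *m dg m w = (dg m w)^T *m dg m v.
Proof.
apply/matrixP => i j; rewrite !mxE; apply: eq_bigr => l _; rewrite !mxE.
have [li|] := eqVneq (l : nat) i; last by rewrite !mulr0n !mul0r.
have [lj|] := eqVneq (l : nat) j; last by rewrite !mulr0n !mulr0.
by rewrite (_ : i = j) ?mulr1n 1?mulrC //; apply: val_inj; rewrite /= -li.
Qed.

(** In a common frame the products of one matrix with the transpose of the other
    are symmetric, hence orthogonal to skew-symmetric matrices. *)
Lemma inner_tangent (U : 'M[R]_m) (V : 'M[R]_n) v w A B :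
  orthogonal_mx U -> orthogonal_mx V -> A^T = - A -> B^T = - B ->
  inner (A *m (U *m dg m v *m V^T) - (U *m dg m v *m V^T) *m B)
        (U *m dg m w *m V^T) = 0.
Proof.
move=> hU hV hA hB; rewrite innerDl innerNl.
rewrite (inner_mulr A) (inner_mull _ B).
have E1 : U *m dg m w *m V^T *m (U *m dg m v *m V^T)^T =
    U *m (dg m w *m (dg m v)^T) *m U^T.
  by rewrite !trmx_mul trmxK !mulmxA -(mulmxA _ (V^T) V) orthE // mulmx1.
have E2 : (U *m dg m v *m V^T)^T *m (U *m dg m w *m V^T) =
    V *m ((dg m v)^T *m dg m w) *m V^T.
  by rewrite !trmx_mul trmxK !mulmxA -(mulmxA _ (U^T) U) orthE // mulmx1.
rewrite E1 E2 !inner_skew_sym ?subrr //.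
- by rewrite trmx_mul trmxK (trmx_mul V) (trmx_mul (_^T)) trmxK dg_tr_mul !mulmxA.
- by rewrite trmx_mul trmxK (trmx_mul U) trmx_mul trmxK dg_mul_tr !mulmxA.
Qed.

End DiagonalProducts.

Section SecondOrderGeneral.
Context {R : realType} {p q : nat}.
Implicit Types (g : 'M[R]_(p, q) -> \bar R) (X Y H Z : 'M[R]_(p, q)).

Lemma quotient_shift (a b : \bar R) (c1 c2 s u : R) :
  a != -oo%E -> b \is a fin_num -> 0 < s -> u <= (c1 - c2) * s ->
  ((a - b - c1%:E) * s%:E + u%:E <= (a - b - c2%:E) * s%:E)%E.
Proof.
case: b => // b; case: a => // [a|] _ _ s0 h.
  by rewrite -!EFinB -!EFinM -EFinD lee_fin; nra.
by rewrite /= !gt0_mulye ?lte_fin // leey.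
Qed.

(** Parabolic arcs are among the arcs that the second subderivative tests. *)
Lemma second_le_parabolic g X Y H Z :
  g X \is a fin_num -> (forall W, g W != -oo%E) -> critical_cone g X Y H ->
  (second_subderivative g X Y H <=
    parabolic_subderivative g X H Z - (inner Y Z)%:E)%E.
Proof.
move=> gX g_ninf crit; rewrite leeBrDr //.
pose theta (tZ : R * 'M[R]_(p, q)) : R * 'M[R]_(p, q) :=
  (tZ.1, H + (2^-1 * tZ.1) *: tZ.2).
have th2 : (theta tZ).2 @[tZ --> dir_filter Z] --> H.
  rewrite -[X in _ --> X]addr0 -(scale0r Z) -(mulr0 2^-1).
  apply: cvgD; first exact: cvg_cst.
  apply: cvgZ; last exact: dir_filter_snd.
  by apply: cvgM; [exact: cvg_cst|exact: dir_filter_tau].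
have thc : theta @ dir_filter Z --> dir_filter H.
  move=> S [[P Q] [/= hP hQ] PQS].
  have h1 : dir_filter Z [set tW | P (theta tW).1] := @dir_filter_fst _ _ _ Z _ hP.
  have h2 : dir_filter Z [set tW | Q (theta tW).2] := th2 _ hQ.
  suff : dir_filter Z (theta @^-1` S) by [].
  apply: (@filterS _ (dir_filter Z) _ _ _ _ (filterI h1 h2)) => tW [Pt Qt].
  exact: (PQS (theta tW) (conj Pt Qt)).
have uc : inner Y tZ.2 @[tZ --> dir_filter Z] --> inner Y Z.
  by apply: cvg_inner; [exact: cvg_cst|exact: dir_filter_snd].
apply: (limf_einf_comparison _ thc uc).
apply: filterS (dir_pos Z) => -[t W] /= t0.
rewrite /parabolic_quotient crit scalerDr scalerA addrA.
have -> : (t * (2^-1 * t) = 2^-1 * t ^+ 2) by ring.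
rewrite -EFinM; apply: quotient_shift => //.
  by rewrite invr_gt0 mulr_gt0 ?exprn_gt0.
rewrite innerDr innerZr.
have -> : ((t * (inner Y H + 2^-1 * t * inner Y W) - t * inner Y H) =
  inner Y W * (2^-1 * t ^+ 2)) by ring.
by rewrite mulfK // mulf_neq0 // expf_neq0 // gt_eqF.
Qed.

End SecondOrderGeneral.

Section SecondOrder.
Context {R : realType} {m n : nat} (hnm : (n <= m)%N).
Variables (f : 'cV[R]_n -> \bar R).
Hypothesis f_sym : absolutely_symmetric f.
Variables (X Y : 'M[R]_(m, n)).
Hypothesis XY_subdiff : subdifferential (f \o sing_vals) X Y.

Notation g := (f \o sing_vals).
Notation x := (svals X).
Notation y := (svals Y).

Variables (H : 'M[R]_(m, n)) (h : 'cV[R]_n).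
Variables (A : 'M[R]_m) (B : 'M[R]_n) (H0 : 'M[R]_(m, n)).
Hypothesis split_H : orbit_split X H A B H0.
Hypothesis svals_h :
  tW.1^-1 *: (svals (X + tW.1 *: tW.2) - x) @[tW --> dir_filter H] --> h.

#[local] Existing Instance dir_filter_filter.

Let hA : A^T = - A. Proof. by case: split_H. Qed.
Let hB : B^T = - B. Proof. by case: split_H. Qed.
Let HE : H = A *m X - X *m B + H0. Proof. by case: split_H. Qed.

Lemma tangent_X_Y : inner (A *m Y - Y *m B) X = 0.
Proof.
have [U [V [/svdE [hU hV XE] /svdE [_ _ YE]]]] :=
  subgradient_common_svd hnm f_sym XY_subdiff.
by rewrite XE YE inner_tangent.
Qed.

Lemma tangent_Y_X : inner (A *m X - X *m B) Y = 0.
Proof.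
have [U [V [/svdE [hU hV XE] /svdE [_ _ YE]]]] :=
  subgradient_common_svd hnm f_sym XY_subdiff.
by rewrite XE YE inner_tangent.
Qed.

(** Twice the coefficient of t^2 in the pairing of X + tH with the orbit arc
    of Y generated by A and B. *)
Definition curvature : R :=
  inner (A *m A *m Y - 2 *: (A *m Y *m B) + Y *m B *m B) X
  + 2 * inner (A *m Y - Y *m B) H.

(** By the trace inequality <y, sigma(X + tW)> dominates the pairing of X + tW
    with any orthogonal motion of Y; the motion generated by (A, B) yields the
    curvature term. *)
Lemma second_subderivative_ge :
  (second_subderivative f x y h + curvature%:E <= second_subderivative g X Y H)%E.
Proof.
have [r rc rE] := expands2_orbit _ (@dir_filter_tau _ _ _ H) hA hB
  (expands2_cst _ _ Y).
set r0 := (X in r @ _ --> X) in rc; rewrite addr0 in rE.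
pose L := A *m Y - Y *m B.
pose u (tW : R * 'M[R]_(m, n)) :=
  2 * (inner (r tW) X + inner L tW.2 + tW.1 * inner (r tW) tW.2).
have uc : u @ dir_filter H --> curvature.
  have -> : curvature = 2 * (inner r0 X + inner L H + 0 * inner r0 H).
    by rewrite /curvature /r0 mulmx0 mul0mx subr0 !addr0 innerZl -/L; field.
  have cs := @dir_filter_snd _ _ _ H.
  rewrite /u; apply: cvgM; first exact: cvg_cst.
  apply: cvgD; last by apply: cvgM; [exact: dir_filter_tau|exact: cvg_inner].
  by apply: cvgD; apply: cvg_inner => //; exact: cvg_cst.
rewrite /second_subderivative /liminf_right.
apply: (limf_einf_comparison _ (theta_cvg svals_h) uc).
apply: filterS (dir_pos H) => -[t W] t0; rewrite [_.1]/= in t0.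
have e := theta_svals X W t0; rewrite [(_, _).2]/= in e.
rewrite ![(_, _).1]/= ![(_, _).2]/= e !compE.
apply: quotient_shift.
- exact: (f_neq_ninfty hnm f_sym XY_subdiff).
- exact: (fx_fin XY_subdiff).
- by rewrite invr_gt0 mulr_gt0 ?exprn_gt0.
rewrite ler_pdivlMr ?mulr_gt0 ?exprn_gt0 //.
have vn := von_neumann hnm (cayley ((2^-1 * t) *: A) *m Y *m (cayley ((2^-1 * t) *: B))^T)
  (X + t *: W).
rewrite sing_vals_orth in vn; try exact: cayley_half_orth.
have := rE (t, W); rewrite [(_, _).1]/= => rEt; rewrite rEt -/L in vn.
have -> : t * inner y (t^-1 *: (svals (X + t *: W) - x)) =
    inner y (svals (X + t *: W)) - inner y x.
  by rewrite innerZr mulrA divff ?gt_eqF // mul1r innerDr innerNr.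
have XY := subgradient_aligned hnm f_sym XY_subdiff.
have LX : inner L X = 0 := tangent_X_Y.
clearbody L; move: vn; rewrite /u [(_, _).1]/= [(_, _).2]/= !inner_lin LX (innerC Y X) XY (innerC y x).
move: (inner _ _) (inner _ _) (inner _ _) (inner _ _) (inner _ _) (inner _ _).
move=> a b c d e' k; nra.
Qed.

Hypothesis H_crit : critical_cone g X Y H.

(** The family X, Y, X + sH0 attains equality in the trace inequality pairwise,
    the last pair by criticality, so the three have a common singular frame. *)
Lemma critical_common_diag U1 V1 :
  svd_pairs X (U1, V1) -> H0 = U1 *m dg m h *m V1^T ->
  (\forall s \near 0^'+, ordered_nonneg (x + s *: h)) ->
  exists U V, [/\ svd_pairs X (U, V), svd_pairs Y (U, V) &
    H0 = U *m dg m h *m V^T].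
Proof.
move=> /svdE [hU1 hV1 X1] H01 ord.
have [s [s0 ords]] : exists s : R, 0 < s /\ ordered_nonneg (x + s *: h).
  have P0 : \forall s \near 0^'+, 0 < s /\ ordered_nonneg (x + s *: h).
    by apply: filterI ord; exact: nbhs_right_gt.
  exact: filter_ex P0.
(* s is so small that the singular values of M are x + sh *)
pose M := X + s *: H0.
have ME : M = U1 *m dg m (x + s *: h) *m V1^T.
  by rewrite dgD dgZ mulmxDr mulmxDl -scalemxAr -scalemxAl -X1 -H01.
have sM : svals M = x + s *: h.
  by rewrite ME sing_vals_orth // sing_vals_dg.
have XM : inner X M = inner x (svals M).
  by rewrite sM ME {1}X1 inner_orth // inner_dg.
have XY := subgradient_aligned hnm f_sym XY_subdiff.
have YM : inner Y M = inner y (svals M).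
  have YH0 : inner Y H0 = inner y h.
    rewrite -(critical_inner hnm f_sym XY_subdiff svals_h H_crit) HE innerDr.
    by rewrite (innerC Y (_ - _)) tangent_Y_X add0r.
  by rewrite sM /M !innerDr !innerZr YH0 (innerC Y X) XY (innerC y x).
pose Z (i : option bool) := if i is Some b then if b then X else Y else M.
have [|U [V hZ]] := @common_svd R m n hnm _ Z.
  move=> [[]|] [[]|]; rewrite /Z ?inner_sing_vals //;
    by rewrite innerC ?XY ?XM ?YM innerC.
have [hU hV XE] := svdE (hZ (Some true)).
have [_ _ ME'] := svdE (hZ None); rewrite /Z in XE ME'.
exists U, V; split; [exact: (hZ (Some true))|exact: (hZ (Some false))|].
have -> : H0 = s^-1 *: (M - X).
  by rewrite /M addrAC subrr add0r scalerA mulVf ?gt_eqF // scale1r.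
rewrite ME' sM dgD mulmxDr mulmxDl -XE addrAC subrr add0r dgZ.
by rewrite -scalemxAr -scalemxAl scalerA mulVf ?gt_eqF // scale1r.
Qed.

Lemma inner_skew_mull P (Q : 'M[R]_(m, n)) :
  inner P (A *m Q) = - inner (A *m P) Q.
Proof. by rewrite inner_mull hA mulNmx innerNr opprK. Qed.

Lemma inner_skew_mulr P (Q : 'M[R]_(m, n)) :
  inner P (Q *m B) = - inner (P *m B) Q.
Proof. by rewrite inner_mulr hB mulmxN innerNr opprK. Qed.

(** Both sides pair the motions AY - YB and AX - XB, as the normal part H0 of H
    shares the frame of Y and is orthogonal to AY - YB. *)
Lemma tangent_pairing U V :
  svd_pairs X (U, V) -> svd_pairs Y (U, V) -> H0 = U *m dg m h *m V^T ->
  inner (A *m Y - Y *m B) H =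
    - inner (A *m A *m Y - 2 *: (A *m Y *m B) + Y *m B *m B) X.
Proof.
move=> /svdE [hU hV XE] /svdE [_ _ YE] H0E.
have L0 : inner (A *m Y - Y *m B) H0 = 0 by rewrite {1 2}YE H0E inner_tangent.
rewrite HE innerDr L0 addr0 !inner_lin !inner_skew_mull !inner_skew_mulr !mulmxA.
by move: (inner _ _) (inner _ _) (inner _ _) => a b c; ring.
Qed.

Lemma curvatureE U V :
  svd_pairs X (U, V) -> svd_pairs Y (U, V) -> H0 = U *m dg m h *m V^T ->
  curvature = inner (A *m Y - Y *m B) H.
Proof.
by move=> sX sY H0E; rewrite /curvature (tangent_pairing sX sY H0E); ring.
Qed.

(** The arc P(t) U dg(x + th + t^2/2 z') V^T Q(t)^T, with P and Q the Cayley
    curves of A and B, has velocity H at X, and f o sigma on it is f along the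
    parabolic arc of z'. *)
Lemma parabolic_arc U V z :
  svd_pairs X (U, V) -> svd_pairs Y (U, V) -> H0 = U *m dg m h *m V^T ->
  exists2 Z, (parabolic_subderivative g X H Z <= parabolic_subderivative f x h z)%E
    & inner Y Z = inner y z - curvature.
Proof.
move=> sX sY H0E; have [hU hV XE] := svdE sX; have [_ _ YE] := svdE sY.
pose D v := U *m dg m v *m V^T.
have eN : expands2 (dir_filter z) (fun tw => tw.1)
    (fun tw => D (x + tw.1 *: h + (2^-1 * tw.1 ^+ 2) *: tw.2))
    X H0 (2^-1 *: D z).
  exists (fun tw => 2^-1 *: D tw.2) => [|[t w] /=].
    apply: cvgZ; first exact: cvg_cst.
    apply: cvg_mulmx; last exact: cvg_cst.
    by apply: cvg_mulmx; [exact: cvg_cst|apply: cvg_dg; exact: dir_filter_snd].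
  rewrite /D !dgD !dgZ !mulmxDr !mulmxDl -!scalemxAr -!scalemxAl -XE -H0E.
  by rewrite scalerA [_ * 2^-1]mulrC.
have [r rc rE] := expands2_orbit _ (@dir_filter_tau _ _ _ z) hA hB eN.
set r0 := (X in r @ _ --> X) in rc; rewrite -HE in rE.
pose theta (tw : R * 'cV[R]_n) : R * 'M[R]_(m, n) := (tw.1, 2 *: r tw).
exists (2 *: r0).
  have thc : theta @ dir_filter z --> dir_filter (2 *: r0).
    move=> S [[P Q] [/= hP hQ] PQS].
    have h1 : dir_filter z [set tW | P (theta tW).1] := @dir_filter_fst _ _ _ z _ hP.
    have th2 : (theta tw).2 @[tw --> dir_filter z] --> 2 *: r0.
      by apply: cvgZ => //; exact: cvg_cst.
    have h2 : dir_filter z [set tW | Q (theta tW).2] := th2 _ hQ.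
    suff : dir_filter z (theta @^-1` S) by [].
    apply: (@filterS _ (dir_filter z) _ _ _ _ (filterI h1 h2)) => tW [Pt Qt].
    exact: (PQS (theta tW) (conj Pt Qt)).
  apply: (limf_einf_le_map _ thc).
  apply: filterS (dir_pos z) => -[t w] t0; rewrite [(_, _).1]/= in t0.
  have /= rtw := rE (t, w).
  rewrite /parabolic_quotient /theta [X in (X <= _)%E]/= [X in (_ <= X)%E]/=.
  rewrite !sing_valsE.
  rewrite scalerA (_ : 2^-1 * t ^+ 2 * 2 = t ^+ 2); last by field.
  rewrite -rtw sing_vals_orth; try exact: cayley_half_orth.
  rewrite /D f_orbit //.
  rewrite H_crit (critical_subderivative hnm f_sym XY_subdiff svals_h H_crit).
  by rewrite (critical_inner hnm f_sym XY_subdiff svals_h H_crit).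
have Yz : inner Y (D z) = inner y z by rewrite {1}YE /D inner_orth // inner_dg.
have L0 : inner (A *m Y - Y *m B) H0 = 0 by rewrite {1 2}YE H0E inner_tangent.
have YX : inner Y (A *m A *m X - 2 *: (A *m X *m B) + X *m B *m B) =
    inner (A *m A *m Y - 2 *: (A *m Y *m B) + Y *m B *m B) X.
  rewrite !inner_lin !inner_skew_mulr // -!(mulmxA A) !inner_skew_mull //.
  by rewrite !mulmxA; move: (inner _ _) (inner _ _) (inner _ _) => a b c; ring.
rewrite /r0 innerZr !innerDr !innerNr !innerZr YX Yz.
rewrite inner_skew_mull // inner_skew_mulr // /curvature (tangent_pairing sX sY) //.
by move: L0; rewrite innerDl innerNl; lra.
Qed.

(** The second subderivative is at most the infimum over parabolic arcs; the arcs
    of parabolic_arc and the parabolic regularity of f bound that infimum by the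
    second subderivative of f plus the curvature, which is in turn a lower bound
    of the second subderivative of f o sigma. *)
Lemma second_subderivative_comp U1 V1 :
  svd_pairs X (U1, V1) -> H0 = U1 *m dg m h *m V1^T ->
  (\forall s \near 0^'+, ordered_nonneg (x + s *: h)) ->
  parabolically_regular f x y ->
  second_subderivative g X Y H = ereal_inf (range (fun Z =>
    (parabolic_subderivative g X H Z - (inner Y Z)%:E)%E)) /\
  second_subderivative g X Y H =
    (second_subderivative f x y h + (inner (A *m Y - Y *m B) H)%:E)%E.
Proof.
move=> hX hH0 ord [_ f_reg].
have [U [V [sX sY H0E]]] := critical_common_diag hX hH0 ord.
rewrite -(curvatureE sX sY H0E).
have h_crit : critical_cone f x y h :=
  critical_subderivative hnm f_sym XY_subdiff svals_h H_crit.
set I := ereal_inf _.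
have le1 : (second_subderivative g X Y H <= I)%E.
  apply: le_ereal_inf_tmp => _ [Z _ <-]; apply: second_le_parabolic => //.
    by case: XY_subdiff.
  by move=> W; rewrite compE; exact: (f_neq_ninfty hnm f_sym XY_subdiff).
have le2 : (I <= second_subderivative f x y h + curvature%:E)%E.
  rewrite -leeBlDr // (f_reg _ h_crit); apply: le_ereal_inf_tmp => _ [z _ <-].
  have [Z le_Z YZ] := parabolic_arc z sX sY H0E.
  rewrite leeBlDr //.
  apply: le_trans (_ : parabolic_subderivative g X H Z - (inner Y Z)%:E <= _)%E.
    by apply: ereal_inf_lbound; exists Z.
  rewrite -addeA; apply: leeD => //.
  by rewrite YZ -?EFinN -?EFinD lee_fin; lra.
have le3 := second_subderivative_ge.
by split; apply/eqP; rewrite eq_le ?le1 ?le3 ?(le_trans le2 le3) ?(le_trans le1 le2).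
Qed.

End SecondOrder.

(** * The rotation generators attached to a singular frame *)

Section Generators.
Context {R : realType} {m n : nat} (hnm : (n <= m)%N).
Notation w := (widen_ord hnm).

(** The entry of the generator for two singular values a, b and the two entries
    p, q of the direction: gen a b p q and gen a b q p solve
      b A - a B = p,  - a A + b B = q    if a and b are distinct,
    if they coincide and are positive, b A - a B = (p - q) / 2 with A = - B; if
    both are zero, A = B = 0. *)
Definition gen (a b p q : R) : R :=
  if a == b then (if a == 0 then 0 else (p - q) / (4 * a))
  else (b * p + a * q) / (b ^+ 2 - a ^+ 2).

Lemma gen_skew a b p q : gen b a q p = - gen a b p q.
Proof.
rewrite /gen eq_sym; case: eqP => [->|_].
  by case: eqP; rewrite ?oppr0 // -mulNr opprB.
by rewrite -[a ^+ 2 - _]opprB invrN mulrN addrC.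
Qed.

(** The n singular values and columns are extended by zero to m indices, so that
    one formula covers the rows beyond the square part. *)
Definition gen_row (x : 'cV[R]_n) (q : 'I_m) : R :=
  if insub (val q) is Some l then x l 0 else 0.

Definition gen_entry (M : 'M[R]_(m, n)) (p q : 'I_m) : R :=
  if insub (val q) is Some l then M p l else 0.

Definition genA (x : 'cV[R]_n) M : 'M[R]_m := \matrix_(p, q)
  gen (gen_row x p) (gen_row x q) (gen_entry M p q) (gen_entry M q p).

Definition genB (x : 'cV[R]_n) (M : 'M[R]_(m, n)) : 'M[R]_n := \matrix_(i, j)
  gen (x i 0) (x j 0) (M (w j) i) (M (w i) j).

Lemma gen_row_in x l : gen_row x (w l) = x l 0.
Proof. by rewrite /gen_row [insub _](_ : _ = Some l) //= valK. Qed.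

Lemma gen_entry_in M p l : gen_entry M p (w l) = M p l.
Proof. by rewrite /gen_entry [insub _](_ : _ = Some l) //= valK. Qed.

Lemma gen_row_out x (q : 'I_m) : (n <= q)%N -> gen_row x q = 0.
Proof. by rewrite /gen_row leqNgt; case: insubP => // l -> . Qed.

Lemma gen_entry_out M p (q : 'I_m) : (n <= q)%N -> gen_entry M p q = 0.
Proof. by rewrite /gen_entry leqNgt; case: insubP => // l -> . Qed.

Lemma genA_skew x M : (genA x M)^T = - genA x M.
Proof. by apply/matrixP => p q; rewrite !mxE gen_skew. Qed.

Lemma genB_skew x M : (genB x M)^T = - genB x M.
Proof. by apply/matrixP => i j; rewrite !mxE gen_skew. Qed.

Lemma genA_in x M l j :
  genA x M (w l) (w j) = gen (x l 0) (x j 0) (M (w l) j) (M (w j) l).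
Proof. by rewrite mxE !gen_row_in !gen_entry_in. Qed.

Lemma genA_out x M (q : 'I_m) j : (n <= q)%N ->
  genA x M q (w j) = gen 0 (x j 0) (M q j) 0.
Proof. by move=> nq; rewrite mxE gen_row_in gen_row_out // gen_entry_in gen_entry_out. Qed.

Lemma mul_dg_entry (A : 'M[R]_m) v p j :
  (A *m dg m v) p j = A p (w j) * v j 0.
Proof.
rewrite mxE (bigD1 (w j)) //= big1 ?addr0 => [|l /negPf lj].
  by rewrite mxE eqxx.
rewrite mxE; case: eqP => [e|_]; last by rewrite mulr0.
by rewrite -val_eqE /= e eqxx in lj.
Qed.

Lemma dg_mul_entry (B : 'M[R]_n) v i j :
  (dg m v *m B) (w i) j = v i 0 * B i j.
Proof.
rewrite mxE (bigD1 i) //= big1 ?addr0 => [|l /negPf lj].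
  by rewrite mxE eqxx.
rewrite mxE; case: eqP => [/= e|_]; last by rewrite mul0r.
by rewrite -val_eqE /= e eqxx in lj.
Qed.

Lemma dg_mul_entry_out (B : 'M[R]_n) v (q : 'I_m) j : (n <= q)%N ->
  (dg m v *m B) q j = 0.
Proof.
move=> nq; rewrite mxE big1 // => l _.
by rewrite mxE gtn_eqF ?mulr0n ?mul0r // (leq_trans (ltn_ord l)).
Qed.

(** The residual of M after removal of the tangent part vanishes between
    distinct singular values and is symmetric within a positive one. *)
Lemma gen_residual x M (M0 := M - (genA x M *m dg m x - dg m x *m genB x M)) :
  ordered_nonneg x ->
  (forall i j, x i 0 * M0 (w j) i = x j 0 * M0 (w i) j /\
               x i 0 * M0 (w i) j = x j 0 * M0 (w j) i) /\
  (forall (q : 'I_m) j, (n <= q)%N -> x j 0 * M0 q j = 0).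
Proof.
case=> x0 _; split=> [i j|q j nq].
  have M0E a b : M0 (w a) b = M (w a) b -
      (gen (x a 0) (x b 0) (M (w a) b) (M (w b) a) * x b 0
       - x a 0 * gen (x a 0) (x b 0) (M (w b) a) (M (w a) b)).
    rewrite /M0 mxE [X in _ + X]mxE [X in _ - X]mxE [X in _ - (_ + X)]mxE.
    by rewrite mul_dg_entry dg_mul_entry genA_in [genB _ _ _ _]mxE.
  rewrite !M0E /gen (eq_sym (x j 0)).
  have [->|xij] := eqVneq (x i 0) (x j 0).
    have [->|xj] := eqVneq (x j 0) 0; first by rewrite !mul0r.
    by split; field.
  have d : x j 0 ^+ 2 - x i 0 ^+ 2 != 0.
    rewrite subr_sqr; apply: mulf_neq0; first by rewrite subr_eq0 eq_sym.
    rewrite paddr_eq0 ?x0 //; apply: contra xij => /andP[/eqP-> /eqP->].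
    by rewrite eqxx.
  have d' : x i 0 ^+ 2 - x j 0 ^+ 2 != 0 by rewrite -opprB oppr_eq0.
  by split; field; rewrite d d'.
have -> : M0 q j = M q j - gen 0 (x j 0) (M q j) 0 * x j 0.
  rewrite /M0 mxE [X in _ + X]mxE [X in _ - X]mxE [X in _ - (_ + X)]mxE.
  by rewrite mul_dg_entry dg_mul_entry_out // genA_out // oppr0 addr0.
rewrite /gen eq_sym; have [->|xj] := eqVneq (x j 0) 0; first by rewrite mul0r.
by field.
Qed.

Variables (X : 'M[R]_(m, n)) (U : 'M[R]_m) (V : 'M[R]_n).
Hypothesis X_svd : svd_pairs X (U, V).
Variable H : 'M[R]_(m, n).
Notation x := (svals X).
Let M := U^T *m H *m V.

Definition frameA : 'M[R]_m := U *m genA x M *m U^T.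
Definition frameB : 'M[R]_n := V *m genB x M *m V^T.

Lemma frame_tangent v :
  frameA *m (U *m dg m v *m V^T) - (U *m dg m v *m V^T) *m frameB =
  U *m (genA x M *m dg m v - dg m v *m genB x M) *m V^T.
Proof.
have [hU hV _] := svdE X_svd.
rewrite /frameA /frameB !mulmxA -(mulmxA _ (U^T) U) orthE // mulmx1.
by rewrite -(mulmxA _ (V^T) V) orthE // mulmx1 mulmxBr mulmxBl !mulmxA.
Qed.

Lemma frame_split :
  orbit_split X H frameA frameB (H - (frameA *m X - X *m frameB)).
Proof.
have [hU hV XE] := svdE X_svd.
pose M0 := M - (genA x M *m dg m x - dg m x *m genB x M).
have HE : H - (frameA *m X - X *m frameB) = U *m M0 *m V^T.
  have -> : frameA *m X - X *m frameB =
      U *m (genA x M *m dg m x - dg m x *m genB x M) *m V^T.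
    by rewrite -frame_tangent -XE.
  rewrite /M0; move: (genA x M *m _ - _) => E.
  rewrite mulmxBr mulmxBl; congr (_ - _).
  by rewrite /M !mulmxA orthE' // mul1mx -mulmxA orthE' // mulmx1.
have [S1 S2] := gen_residual M (sing_vals_ordered X).
rewrite -/M0 in S1 S2.
have sym1 : (dg m x *m M0^T)^T = dg m x *m M0^T.
  apply/matrixP => p q; rewrite mxE.
  have [[i ->]|np] := row_index_cases hnm p; have [[j ->]|nq] := row_index_cases hnm q.
  - by rewrite !dg_tr_entry (S1 i j).1.
  - by rewrite dg_tr_entry dg_tr_entry_out // S2.
  - by rewrite dg_tr_entry dg_tr_entry_out // S2.
  - by rewrite !dg_tr_entry_out.
have sym2 : ((dg m x)^T *m M0)^T = (dg m x)^T *m M0.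
  by apply/matrixP => i j; rewrite mxE !(tr_dg_entry hnm) (S1 j i).2.
split.
- by rewrite /frameA trmx_mul trmxK trmx_mul genA_skew mulNmx mulmxN mulmxA.
- by rewrite /frameB trmx_mul trmxK trmx_mul genB_skew mulNmx mulmxN mulmxA.
- by rewrite addrC subrK.
- rewrite HE; have -> : X *m (U *m M0 *m V^T)^T = U *m (dg m x *m M0^T) *m U^T.
    rewrite {1}XE !trmx_mul trmxK !mulmxA -(mulmxA _ (V^T) V) orthE // mulmx1.
    by [].
  by rewrite trmx_mul trmxK (trmx_mul U) sym1 mulmxA.
- rewrite HE; have -> : X^T *m (U *m M0 *m V^T) = V *m ((dg m x)^T *m M0) *m V^T.
    by rewrite {1}XE !trmx_mul trmxK !mulmxA -(mulmxA _ (U^T) U) orthE // mulmx1.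
  by rewrite trmx_mul trmxK (trmx_mul V) sym2 mulmxA.
Qed.

End Generators.

(** * The second-order term in coordinates *)

Section Rank.
Context {R : realType} {m n : nat} (hnm : (n <= m)%N).

(** The zeros of an ordered nonnegative vector form a final segment. *)
Lemma ordered_support (x : 'cV[R]_n) : ordered_nonneg x ->
  exists2 r, (r <= n)%N & forall s : 'I_n, (s < r)%N = (x s 0 != 0).
Proof.
case=> x0 xi; pose P k := [forall s : 'I_n, (k <= s)%N ==> (x s 0 == 0)].
have Pn : P n by apply/forallP => s; rewrite leqNgt ltn_ord.
have [r /forallP Pr rmin] := ex_minnP (ex_intro P n Pn).
exists r => [|s]; first exact: rmin.
apply/idP/idP => [sr|]; last first.
  by apply: contraR; rewrite -leqNgt => rs; exact: (implyP (Pr s)).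
apply: contraL sr => /eqP xs; rewrite -leqNgt; apply: rmin.
apply/forallP => k; apply/implyP => /xi; rewrite xs => xk.
by rewrite eq_le xk x0.
Qed.

Lemma rank_svals (X : 'M[R]_(m, n)) (s : 'I_n) : (s < \rank X)%N = (svals X s 0 != 0).
Proof.
have [U [V /svdE [hU hV XE]]] := svd_exists hnm X.
have [r rn rE] := ordered_support (sing_vals_ordered X).
suff -> : \rank X = r by [].
have uU : U \in unitmx by case: (mulmx1_unit (orthE hU)).
have uV : V^T \in unitmx by case: (mulmx1_unit (orthE hV)).
rewrite XE mxrankMfree ?row_free_unit //.
rewrite (eqmxMfull _ (_ : row_full U)) ?row_full_unit //.
pose d : 'rV[R]_n := \row_i (if svals X i 0 == 0 then 1 else svals X i 0).
have -> : dg m (svals X) = (pid_mx r : 'M[R]_(m, n)) *m diag_mx d.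
  apply/matrixP => i j; rewrite mul_mx_diag !mxE.
  case: eqP => [ij|_]; last by rewrite mul0r.
  rewrite ij rE; case: eqP => [->|_]; first by rewrite mul0r.
  by rewrite mul1r.
rewrite mxrankMfree ?rank_pid_mx ?(leq_trans rn) // row_free_unit unitmxE det_diag.
rewrite unitfE; apply/prodf_neq0 => i _; rewrite mxE.
by case: ifP => [_|/negbT //]; exact: oner_neq0.
Qed.

End Rank.

Section SubmatrixSums.
Context {R : realType}.

Lemma sum_idx k (I : {set 'I_k}) (F : 'I_k -> R) :
  \sum_(a < #|I|) F (idx I a) = \sum_(i in I) F i.
Proof. by rewrite [RHS]big_enum_val. Qed.

Lemma invmx_diag k (v : 'rV[R]_k) : (forall i, v 0 i != 0) ->
  invmx (diag_mx v) = diag_mx (\row_i (v 0 i)^-1).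
Proof.
move=> v0; set W := diag_mx (\row_i _).
have VW : diag_mx v *m W = 1%:M.
  apply/matrixP => i j; rewrite mul_diag_mx !mxE.
  by case: eqP => [->|_]; rewrite ?mulr0n ?mulr0 // !mulr1n divff.
have [uv _] := mulmx1_unit VW.
by rewrite -[LHS]mulmx1 -VW mulmxA mulVmx // mul1mx.
Qed.

Lemma trmxZ k l c (A : 'M[R]_(k, l)) : (c *: A)^T = c *: A^T.
Proof. by apply/matrixP => i j; rewrite !mxE. Qed.

Lemma entry_form k l p q (A : 'M[R]_(k, p)) (Z : 'M[R]_(k, l)) (B : 'M[R]_(l, q)) i j :
  (A^T *m Z *m B) i j = ((col i A)^T *m Z *m col j B) 0 0.
Proof.
rewrite !mxE; apply: eq_bigr => a _; rewrite !mxE; congr (_ * _).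
by apply: eq_bigr => b _; rewrite !mxE.
Qed.

End SubmatrixSums.

Section Formula.
Context {R : realType} {m n : nat} (hnm : (n <= m)%N).
Notation w := (widen_ord hnm).
Variables (X Y : 'M[R]_(m, n)) (U : 'M[R]_m) (V : 'M[R]_n).
Hypotheses (X_svd : svd_pairs X (U, V)) (Y_svd : svd_pairs Y (U, V)).
Variable H : 'M[R]_(m, n).
Notation x := (svals X).
Notation y := (svals Y).
Let M := U^T *m H *m V.

Let PU : 'M[R]_(m, _) :=
  row_mx (row_mx (row_mx (row_mx (colsub (widx hnm (alpha X)) U)
                                 (colsub (widx hnm (beta X)) U))
                         (Num.sqrt 2 *: colsub (idx (beta0 m n)) U))
                 (- colsub (widx hnm (alpha X)) U))
         (- colsub (widx hnm (beta X)) U).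
Let PV : 'M[R]_(n, _) :=
  row_mx (row_mx (row_mx (row_mx (colsub (idx (alpha X)) V)
                                 (colsub (idx (beta X)) V))
                         (0 : 'M[R]_(n, #|beta0 m n|)))
                 (colsub (idx (alpha X)) V))
         (colsub (idx (beta X)) V).

Lemma sqrt2_inv : (Num.sqrt 2)^-1 * (Num.sqrt 2)^-1 = 2^-1 :> R.
Proof. by rewrite -invfM -expr2 sqr_sqrtr. Qed.

Lemma dilation_form Z p q (A : 'M[R]_(m, p)) (B : 'M[R]_(n, p))
    (A' : 'M[R]_(m, q)) (B' : 'M[R]_(n, q)) :
  ((Num.sqrt 2)^-1 *: col_mx A B)^T *m sym_dilation Z
    *m ((Num.sqrt 2)^-1 *: col_mx A' B') =
  2^-1 *: (B^T *m Z^T *m A' + A^T *m Z *m B').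
Proof.
rewrite trmxZ tr_col_mx -!scalemxAl -scalemxAr scalerA sqrt2_inv.
by rewrite mul_row_block !mulmx0 add0r addr0 mul_row_col.
Qed.

Lemma frame_entry Z p l (c d : R) :
  ((c *: col p U)^T *m Z *m (d *: col l V)) 0 0 = c * d * (U^T *m Z *m V) p l.
Proof.
rewrite entry_form trmxZ -!scalemxAl -scalemxAr scalerA mxE mulrC.
by rewrite [c * d]mulrC mulrC.
Qed.

(** Each column of the eigenvector matrix P is described by the multiples (c, d)
    of the singular vectors (p, l) stacked in it; summing over the five column
    blocks then amounts to summing over the pairs (l, l) with signs 1 and -1 and
    over the left singular vectors q >= n. *)
Lemma sum_columns (F : 'I__ -> R) (S : R -> 'I_m -> R -> 'I_n -> R) (i0 : 'I_n) :
  (forall k c p d l, col k PU = c *: col p U -> col k PV = d *: col l V ->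
     F k = S c p d l) ->
  \sum_k F k = \sum_l S 1 (w l) 1 l + \sum_l S (-1) (w l) 1 l +
    \sum_(q < m | (n <= q)%N) S (Num.sqrt 2) q 0 i0.
Proof.
move=> FS.
have split_ab (G : 'I_n -> R) :
    \sum_l G l = \sum_(a < #|alpha X|) G (idx (alpha X) a)
               + \sum_(b < #|beta X|) G (idx (beta X) b).
  rewrite !sum_idx (bigID (mem (alpha X))) /=; congr (_ + _).
  by apply: eq_bigl => l; rewrite !inE -leqNgt.
rewrite (split_ab (fun l => S 1 (w l) 1 l)) (split_ab (fun l => S (-1) (w l) 1 l)).
have -> : \sum_(q < m | (n <= q)%N) S (Num.sqrt 2) q 0 i0 =
    \sum_(a < #|beta0 m n|) S (Num.sqrt 2) (idx (beta0 m n) a) 0 i0.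
  by rewrite (sum_idx _ (fun q => S (Num.sqrt 2) q 0 i0)); apply: eq_bigl => q; rewrite inE.
rewrite 4!big_split_ord /=.
rewrite [RHS]addrAC !addrA; congr (_ + _ + _ + _ + _); apply: eq_bigr => a _;
  apply: FS; apply/colP => q; rewrite [LHS]mxE;
  by rewrite ?(row_mxEl, row_mxEr) !mxE ?mul1r ?mulN1r ?mul0r.
Qed.

Let PE : Pmx hnm X U V = (Num.sqrt 2)^-1 *: col_mx PU PV.
Proof. by []. Qed.

Lemma tr_sym_dilation Z : (sym_dilation Z)^T = sym_dilation Z :> 'M[R]_(m + n).
Proof. by rewrite /sym_dilation tr_block_mx !trmx0 trmxK. Qed.

Lemma frame_entry_tr Z p l (c d : R) :
  ((d *: col l V)^T *m Z^T *m (c *: col p U)) 0 0 = c * d * (U^T *m Z *m V) p l.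
Proof.
have -> : (d *: col l V)^T *m Z^T *m (c *: col p U) =
    ((c *: col p U)^T *m Z *m (d *: col l V))^T.
  by rewrite !trmx_mul trmxK mulmxA.
by rewrite mxE frame_entry.
Qed.

Lemma U_X_V : U^T *m X *m V = dg m x.
Proof.
have [hU hV XE] := svdE X_svd.
by rewrite {1}XE !mulmxA orthE // mul1mx -mulmxA orthE // mulmx1.
Qed.

(** Half the coefficient of y_i in the curvature when x_i = a > 0, as a sum over
    the eigenvectors of the dilation of X.  Inverses of zero being zero, the sums
    extend over all indices. *)
Definition pole_sum (a : R) (i : 'I_n) : R :=
  \sum_l (2^-1 * (M (w l) i + M (w i) l)) ^+ 2 / (a - x l 0) +
  \sum_l (2^-1 * (M (w i) l - M (w l) i)) ^+ 2 / (a + x l 0) +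
  \sum_(q < m | (n <= q)%N) 2^-1 * M q i ^+ 2 / a.

Lemma col_colsub k l p (f : 'I_k -> 'I_l) (A : 'M[R]_(p, l)) j :
  col j (colsub f A) = col (f j) A.
Proof. by apply/colP => q; rewrite !mxE. Qed.

(** The columns of P left out of the matrix of the complement are those for which
    mu is an eigenvalue, and for them the quotient by zero is zero: the sum over
    the complement is a sum over all columns. *)
Lemma alpha_form_diag (mu : R) (a : 'I_#|alpha_mu X mu|) :
  ((Pmu hnm X U V mu)^T *m sym_dilation H *m Pmu_c hnm X U V mu
     *m invmx (mu%:M - Lambda_mu hnm X U V mu)
     *m (Pmu_c hnm X U V mu)^T *m sym_dilation H *m Pmu hnm X U V mu) a a
  = pole_sum mu (idx _ a).
Proof.
set I := alpha_mu X mu in a *; set i := idx I a.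
pose D := (Pmx hnm X U V)^T *m sym_dilation X *m Pmx hnm X U V.
pose E := (Pmu hnm X U V mu)^T *m sym_dilation H *m Pmx hnm X U V.
pose K := non_mu hnm X U V mu.
pose v : 'rV[R]_#|K| := \row_k (mu - D (idx K k) (idx K k)).
pose C := (Pmu hnm X U V mu)^T *m sym_dilation H *m Pmu_c hnm X U V mu.
have CE k : C a k = E a (idx K k).
  rewrite /C /E !mxE; apply: eq_bigr => l _; congr (_ * _).
  by rewrite /Pmu_c mxE.
have -> : mu%:M - Lambda_mu hnm X U V mu = diag_mx v.
  apply/matrixP => k l; rewrite !mxE; case: eqP => [->|_].
    by rewrite !mulr1n.
  by rewrite !mulr0n subr0.
rewrite -(mulmxA _ (sym_dilation H)) -(mulmxA _ ((Pmu_c _ _ _ _ _)^T)).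
have -> : (Pmu_c hnm X U V mu)^T *m (sym_dilation H *m Pmu hnm X U V mu) = C^T.
  by rewrite /C !trmx_mul trmxK tr_sym_dilation.
rewrite -/C invmx_diag => [|k]; last first.
  rewrite mxE subr_eq0 eq_sym; have := enum_valP k; by rewrite inE.
have -> : (C *m diag_mx (\row_k (v 0 k)^-1) *m C^T) a a =
    \sum_(k < #|K|) E a (idx K k) ^+ 2 / (mu - D (idx K k) (idx K k)).
  rewrite mul_mx_diag mxE; apply: eq_bigr => k _.
  rewrite [X in X * _]mxE [X in _ * X]mxE CE [X in _ * X * _]mxE [v 0 k]mxE.
  by rewrite expr2 mulrAC.
rewrite (sum_idx K (fun k => E a k ^+ 2 / (mu - D k k))).
have -> : \sum_(k in K) E a k ^+ 2 / (mu - D k k) =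
    \sum_k E a k ^+ 2 / (mu - D k k).
  rewrite [RHS](bigID (mem K)) /= [X in _ + X]big1 ?addr0 // => k.
  by rewrite inE negbK => /eqP ->; rewrite subrr invr0 mulr0.
pose S (c : R) (p : 'I_m) (d : R) (l : 'I_n) :=
  (2^-1 * (c * M p i + d * M (w i) l)) ^+ 2 / (mu - c * d * dg m x p l).
rewrite (@sum_columns _ S i) => [|k c p d l hPU hPV].
  rewrite /pole_sum; congr (_ + _ + _); apply: eq_bigr => l.
  - by move=> _; rewrite /S !mul1r dgE eqxx.
  - move=> _; rewrite /S mulr1 !mulN1r mul1r dgE eqxx mulr1n opprK.
    by rewrite [- _ + _]addrC.
  - move=> _; rewrite /S mul0r addr0 mulr0 mul0r subr0; congr (_ / _).
    by rewrite !exprMn sqr_sqrtr //; field.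
rewrite /S; congr (_ / _); [congr (_ ^+ 2)|congr (_ - _)].
- rewrite /E /Pmu PE dilation_form mxE mxE.
  rewrite [X in _ * (X + _)]entry_form [X in _ * (_ + X)]entry_form hPU hPV.
  rewrite !col_colsub -[col (idx _ a) V]scale1r -[col (widx _ _ a) U]scale1r.
  by rewrite frame_entry_tr frame_entry mulr1 mul1r.
- rewrite /D PE dilation_form mxE mxE.
  rewrite [X in _ * (X + _)]entry_form [X in _ * (_ + X)]entry_form hPU hPV.
  by rewrite frame_entry_tr frame_entry U_X_V; field.
Qed.

Lemma alpha_termE (mu : R) :
  alpha_term hnm X U V Y H mu =
    \sum_(i in alpha_mu X mu) y i 0 * pole_sum mu i.
Proof.
rewrite /alpha_term; move: (@alpha_form_diag mu).
move: (_ *m Pmu hnm X U V mu) => T TE; rewrite innerE.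
rewrite -(sum_idx _ (fun i => y i 0 * pole_sum mu i)); apply: eq_bigr => a _.
rewrite (bigD1 a) //= big1 ?addr0 => [|b ba].
  by rewrite TE mxE Sigma_dg dgE eqxx.
rewrite mxE Sigma_dg dgE /= (_ : (_ == _ :> nat) = false) ?mulr0n ?mul0r //.
apply/negP => /eqP /val_inj /enum_val_inj ab; by rewrite ab eqxx in ba.
Qed.

Lemma Sigma_alphaE :
  invmx (Sigma_alpha hnm X) = diag_mx (\row_k (x (idx (alpha X) k) 0)^-1).
Proof.
have -> : Sigma_alpha hnm X = diag_mx (\row_k x (idx (alpha X) k) 0).
  apply/matrixP => a b; rewrite /Sigma_alpha Sigma_dg !mxE /=.
  case: eqVneq => [/val_inj /enum_val_inj ->|ab]; first by rewrite eqxx.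
  by case: eqP => // ab'; rewrite ab' eqxx in ab.
rewrite invmx_diag; first by congr diag_mx; apply/rowP => k; rewrite !mxE.
move=> k; rewrite mxE -(rank_svals hnm); have := enum_valP k.
by rewrite inE.
Qed.

Lemma beta_termE : beta_term hnm X U V Y H =
  - \sum_(i in beta X) y i 0 * \sum_l M (w i) l * M (w l) i / x l 0.
Proof.
rewrite /beta_term Sigma_alphaE.
set T := (X in inner _ X).
pose G (p : 'I_m) (i : 'I_n) := \sum_(l in alpha X) M p l * M (w l) i / x l 0.
have TE p i : T p i = - G (idx _ p) (idx _ i).
  rewrite /T !mulNmx mxE; congr (- _).
  set Dx := diag_mx _.
  have assoc (A1 : 'M[R]_(#|betahat X|, m)) (A2 : 'M[R]_(n, #|alpha X|))
      (A3 : 'M[R]_(#|alpha X|, m)) (A4 : 'M[R]_(n, #|beta X|)) :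
      A1 *m H *m A2 *m Dx *m A3 *m H *m A4 =
      (A1 *m H *m A2 *m Dx) *m (A3 *m H *m A4) by rewrite !mulmxA.
  rewrite assoc mxE /G.
  rewrite -(sum_idx _ (fun l => M (idx _ p) l * M (w l) (idx _ i) / x l 0)).
  apply: eq_bigr => k _; rewrite mul_mx_diag [X in X * _]mxE [(\row_ _ _) _ _]mxE.
  have ME q' j' : M q' j' = ((col q' U)^T *m H *m col j' V) 0 0.
    by rewrite /M entry_form.
  by rewrite !ME mulrAC [in LHS]entry_form (entry_form _ _ _ k) !col_colsub.
rewrite innerE -sumrN -(sum_idx _ (fun i => - (y i 0 * \sum_l M (w i) l * M (w l) i / x l 0))).
rewrite exchange_big; apply: eq_bigr => b _; set i := idx _ b.
have bi : w i \in betahat X by rewrite inE; have := enum_valP b; rewrite inE.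
rewrite (eq_bigr (fun p => dg m y (idx _ p) i * - G (idx _ p) i)) => [|p _]; last first.
  by rewrite TE mxE Sigma_dg.
rewrite (sum_idx _ (fun q => dg m y q i * - G q i)) (bigD1 (w i)) //= big1 ?addr0 => [|q /andP[_ qi]]; last first.
  rewrite dgE; case: eqP => [e|_]; last by rewrite mul0r.
  by case/eqP: qi; apply: val_inj.
rewrite dgE eqxx mulr1n mulrN; congr (- (_ * _)).
rewrite /G [RHS](bigID (mem (alpha X))) /= [X in _ = _ + X]big1 ?addr0 // => l.
by rewrite inE rank_svals // negbK => /eqP ->; rewrite invr0 mulr0.
Qed.

Definition curvature_coef (i : 'I_n) : R :=
  \sum_q genA x M q (w i) * M q i - \sum_l genB hnm x M i l * M (w i) l.

Lemma frame_pairing :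
  inner (frameA X U V H *m Y - Y *m frameB hnm X U V H) H =
  \sum_i y i 0 * curvature_coef i.
Proof.
have [hU hV YE] := svdE Y_svd.
rewrite {1 2}YE frame_tangent // inner_mulr trmxK inner_mull mulmxA -/M.
rewrite innerDl innerNl !innerE exchange_big /=.
rewrite [X in _ - X](bigID (fun q : 'I_m => (q < n)%N)) /=.
rewrite [X in _ - (_ + X)]big1 ?addr0 => [|q]; last first.
  by rewrite -leqNgt => nq; rewrite big1 // => j _; rewrite dg_mul_entry_out ?mul0r.
rewrite big_ord_narrow -sumrB; apply: eq_bigr => i _.
rewrite /curvature_coef mulrBr !mulr_sumr; congr (_ - _); apply: eq_bigr => j _.
  by rewrite (mul_dg_entry hnm) mulrAC mulrC mulrA.
by rewrite dg_mul_entry mulrA.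
Qed.

Lemma sum_rows (F : 'I_m -> R) :
  \sum_q F q = \sum_l F (w l) + \sum_(q < m | (n <= q)%N) F q.
Proof.
rewrite (bigID (fun q : 'I_m => (q < n)%N)) /= big_ord_narrow; congr (_ + _).
by apply: eq_bigl => q; rewrite [RHS]leqNgt.
Qed.

(** For x_l distinct from x_i this is the partial fraction decomposition of the
    generators, whose denominator is x_i^2 - x_l^2. *)
Lemma curvature_coef_pos i : x i 0 != 0 ->
  curvature_coef i = 2 * pole_sum (x i 0) i.
Proof.
move=> xi; rewrite /curvature_coef sum_rows addrAC -sumrB /pole_sum.
rewrite -big_split /= mulrDr !mulr_sumr; congr (_ + _); apply: eq_bigr => l.
  move=> _; rewrite genA_in [genB _ _ _ _ _]mxE /gen (eq_sym (x l 0)).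
  have [x0 _] := sing_vals_ordered X.
  have [xl|xl] := eqVneq (x i 0) (x l 0).
    rewrite -xl (negPf xi) subrr invr0 mulr0 add0r.
    have s : x i 0 + x i 0 != 0 by rewrite -mulr2n mulrn_eq0.
    by field; rewrite s xi.
  have s : x i 0 + x l 0 != 0 by rewrite paddr_eq0 ?x0 // (negPf xi).
  have d : x i 0 - x l 0 != 0 by rewrite subr_eq0.
  have d1 : x i 0 ^+ 2 - x l 0 ^+ 2 != 0 by rewrite subr_sqr mulf_neq0.
  have d2 : x l 0 ^+ 2 - x i 0 ^+ 2 != 0 by rewrite -opprB oppr_eq0.
  by field; rewrite s d d1 d2.
move=> nl; rewrite genA_out // /gen eq_sym (negPf xi).
by field.
Qed.

Lemma curvature_coef_zero i : x i 0 = 0 ->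
  curvature_coef i = - (2 * \sum_l M (w i) l * M (w l) i / x l 0).
Proof.
move=> xi; rewrite /curvature_coef sum_rows addrAC -sumrB.
rewrite [X in _ + X]big1 ?addr0 => [|q nq]; last first.
  by rewrite genA_out // /gen xi !eqxx mul0r.
rewrite mulr_sumr -sumrN; apply: eq_bigr => l _.
rewrite genA_in [genB _ _ _ _ _]mxE /gen xi (eq_sym 0).
have [->|xl] := eqVneq (x l 0) 0; first by rewrite eqxx invr0; ring.
by field.
Qed.

(** The singular indices are grouped by their values mu_i, and those of the zero
    singular value make up the beta term. *)
Lemma frame_pairing_formula (t : nat) (mu : 'I_t -> R) : injective mu ->
  (forall z : R, (exists i, mu i = z) <-> (z != 0 /\ exists s, x s 0 = z)) ->
  inner (frameA X U V H *m Y - Y *m frameB hnm X U V H) H =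
  2 * \sum_(i < t) alpha_term hnm X U V Y H (mu i)
  + 2 * beta_term hnm X U V Y H.
Proof.
move=> mu_inj mu_x; rewrite frame_pairing beta_termE.
have -> : \sum_(j < t) alpha_term hnm X U V Y H (mu j) =
    \sum_(i in alpha X) y i 0 * pole_sum (x i 0) i.
  under eq_bigr do rewrite alpha_termE.
  rewrite (exchange_big_dep (mem (alpha X))) /= => [|j i _]; last first.
    by rewrite inE => /andP[].
  apply: eq_bigr => i ia.
  have xi : x i 0 != 0 by rewrite -(rank_svals hnm); move: ia; rewrite inE.
  have [j muj] : exists j, mu j = x i 0 by apply/mu_x; split => //; exists i.
  rewrite (big_pred1 j) => [|k]; first by rewrite muj.
  by rewrite inE ia /= sing_valsE -muj eq_sym (inj_eq mu_inj).
rewrite (bigID (mem (alpha X))) /= mulrN !mulr_sumr -sumrN; congr (_ + _).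
  apply: eq_bigr => i; rewrite inE (rank_svals hnm) => xi.
  by rewrite curvature_coef_pos // mulrCA.
apply: eq_big => [i|i]; first by rewrite !inE -leqNgt.
rewrite inE (rank_svals hnm) negbK => /eqP xi.
by rewrite curvature_coef_zero // mulrN mulrCA.
Qed.

End Formula.

(** * Parabolic regularity and the second subderivative of f o sigma *)

Theorem theorem5p6 (R : realType) (m n : nat) (hnm : (n <= m)%N)
    (f : 'cV[R]_n -> \bar R)
    (f_sym : absolutely_symmetric f)
    (f_lsc : lower_semicontinuous f)
    (f_convex : econvex f)
    (f_lip : locally_lipschitz_rel_dom f)
    (X Y : 'M[R]_(m, n))
    (t : nat) (mu : 'I_t -> R)
    (mu_decr : forall i j : 'I_t, (i < j)%N -> mu j < mu i)
    (mu_sing : forall x : R,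
       (exists i, mu i = x) <-> (x != 0 /\ exists s, sing_vals X s 0 = x))
    (XY_subdiff : subdifferential (f \o sing_vals) X Y)
    (f_epi : parabolically_epi_differentiable f (sing_vals X))
    (f_reg : parabolically_regular f (sing_vals X) (sing_vals Y)) :
  parabolically_regular (f \o sing_vals) X Y /\
  forall H : 'M[R]_(m, n), critical_cone (f \o sing_vals) X Y H ->
  forall (U : 'M[R]_m) (V : 'M[R]_n),
    svd_pairs X (U, V) -> svd_pairs Y (U, V) ->
    second_subderivative (f \o sing_vals) X Y H =
    (second_subderivative f (sing_vals X) (sing_vals Y)
                          (sing_vals_dderiv X H)
     + (2 * \sum_(i < t) alpha_term hnm X U V Y H (mu i))%:E
     + (2 * beta_term hnm X U V Y H)%:E)%E.
Proof.
have g_fin := XY_subdiff.1.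
have main H U V : critical_cone (f \o sing_vals) X Y H ->
    svd_pairs X (U, V) -> svd_pairs Y (U, V) ->
    second_subderivative (f \o sing_vals) X Y H = ereal_inf (range (fun Z =>
      (parabolic_subderivative (f \o sing_vals) X H Z - (inner Y Z)%:E)%E)) /\
    second_subderivative (f \o sing_vals) X Y H =
      (second_subderivative f (sing_vals X) (sing_vals Y) (sing_vals_dderiv X H)
       + (2 * \sum_(i < t) alpha_term hnm X U V Y H (mu i)
          + 2 * beta_term hnm X U V Y H)%:E)%E.
  move=> H_crit sX sY.
  have split_H := frame_split hnm sX H; set H0 := H - _ in split_H.
  have [_ _ _ sym1 sym2] := split_H.
  have [U1 [V1 [h [sX1 H0E ord]]]] := common_diag hnm sym1 sym2.
  have sh := svals_directional hnm split_H sX1 H0E ord.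
  rewrite !sing_valsE in f_reg.
  have [-> ->] := second_subderivative_comp hnm f_sym XY_subdiff split_H sh H_crit
    sX1 H0E ord f_reg.
  rewrite (dderiv_eq sh) !sing_valsE; split=> //; congr (_ + _%:E)%E.
  apply: frame_pairing_formula => // [i j /eqP|z]; last first.
    by rewrite mu_sing sing_valsE.
  apply: contraTeq; rewrite neq_ltn => /orP[] ij.
    by rewrite gt_eqF // mu_decr.
  by rewrite lt_eqF // mu_decr.
split=> [|H H_crit U V sX sY].
  have [U [V [sX sY]]] := subgradient_common_svd hnm f_sym XY_subdiff.
  by split=> // H H_crit; have [] := main H U V H_crit sX sY.
by have [_ ->] := main H U V H_crit sX sY; rewrite EFinD addeA.
Qed.
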